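(* Let $\Omega\subset\mathbb{H}$ be a slice contractible circular domain and let $g\in\mathcal{R}(\Omega)$ be never vanishing. If $g$ is one-slice preserving, then there exists $f\in\mathcal{R}(\Omega)$ which preserves the same slice as $g$ and such that $\exp_*(f)=g$. Moreover: (a) if $\Omega$ is a slice domain, $g$ is slice preserving and positive on $\Omega\cap\mathbb{R}$, then there exists a unique slice preserving $*$-logarithm of $g$; (b) if $\Omega$ is a product domain and $g$ is slice preserving, then there exists a slice preserving $*$-logarithm of $g$.
   Context: $\mathbb{H}$ is the algebra of quaternions; $q=q_0+q_v$ with $q_0$ real and $q_v$ purely imaginary, $\mathbb{S}=\{I\in\mathbb{H}: I^2=-1\}$, $\mathbb{C}_I=\mathbb{R}+\mathbb{R}I$, $\mathbb{C}_I^+=\{\alpha+I\beta:\beta\ge0\}$, $\mathbb{S}_q=\{q_0+\|q_v\|J: J\in\mathbb{S}\}$, $\Omega_I=\Omega\cap\mathbb{C}_I$, $\Omega_I^+=\Omega\cap\mathbb{C}_I^+$. A domain (nonempty connected open set) $\Omega\subset\mathbb{H}$ is circular if $\mathbb{S}_q\subset\Omega$ for all $q\in\Omega$; it is a slice domain if $\Omega\cap\mathbb{R}\neq\emptyset$ and a product domain if $\Omega\cap\mathbb{R}=\emptyset$. It is slice contractible if, for some (equivalently any) $I\in\mathbb{S}$, $\Omega_I$ is a simply connected domain when $\Omega$ is slice, respectively $\Omega_I^+$ is a simply connected domain when $\Omega$ is product. A function $f:\Omega\to\mathbb{H}$ is slice regular if $f(\alpha+I\beta)=F_0(\alpha+\sqrt{-1}\beta)+I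 F_1(\alpha+\sqrt{-1}\beta)$ for all $I\in\mathbb{S}$ and $\alpha,\beta\in\mathbb{R}$ with $\alpha+I\beta\in\Omega$, where $F_0,F_1:\{\alpha+\sqrt{-1}\beta:\alpha+I\beta\in\Omega\}\to\mathbb{H}$ are $C^1$, $F_0(\bar z)=F_0(z)$, $F_1(\bar z)=-F_1(z)$ and $\partial_\alpha F_0=\partial_\beta F_1$, $\partial_\beta F_0=-\partial_\alpha F_1$. $\mathcal{R}(\Omega)$ is the set of slice regular functions. $f\in\mathcal{R}(\Omega)$ is one-slice preserving (preserves the slice $\mathbb{C}_I$) if $f(\Omega_I)\subset\mathbb{C}_I$ for some $I\in\mathbb{S}$, and slice preserving if $f(\Omega_I)\subset\mathbb{C}_I$ for all $I\in\mathbb{S}$. The $*$-product is $(f*g)(q)=0$ if $f(q)=0$, and $(f*g)(q)=f(q)\,g(f(q)^{-1}qf(q))$ otherwise. $\exp_*(f)=\sum_{n\ge0}f^{*n}/n!$, with $f^{*n}$ the $n$-th $*$-power. A $*$-logarithm of a never vanishing $g\in\mathcal{R}(\Omega)$ is an $f\in\mathcal{R}(\Omega)$ with $\exp_*(f)=g$. *)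

(* Defs.v *)
From HB Require Import structures.
From mathcomp Require Import all_boot all_order all_algebra.
From mathcomp Require Import ring lra.
From mathcomp Require Import all_classical all_reals all_analysis.

Set Implicit Arguments.
Unset Strict Implicit.
Unset Printing Implicit Defensive.

Import Order.TTheory GRing.Theory Num.Theory.
Import numFieldNormedType.Exports.

Local Open Scope classical_set_scope.
Local Open Scope ring_scope.

(* Quat a b c d stands for a + b i + c j + d k. *)
Record quat (R : realType) := Quat { qre : R; qi : R; qj : R; qk : R }.

Section QuaternionAlgebra.
Variable R : realType.
Implicit Types p q : quat R.

Definition quat_to_prod q : R * R * R * R := (qre q, qi q, qj q, qk q).

Definition quat_of_prod (x : R * R * R * R) : quat R :=
  let: (a, b, c, d) := x in Quat a b c d.

Fact quat_to_prodK : cancel quat_to_prod quat_of_prod.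
Proof. by case. Qed.

HB.instance Definition _ := Choice.copy (quat R) (can_type quat_to_prodK).

Definition qzero : quat R := Quat 0 0 0 0.

Definition qone : quat R := Quat 1 0 0 0.

Definition qopp q : quat R :=
  let: Quat a b c d := q in Quat (- a) (- b) (- c) (- d).

Definition qadd p q : quat R :=
  let: Quat a b c d := p in
  let: Quat a' b' c' d' := q in Quat (a + a') (b + b') (c + c') (d + d').

Definition qscale (k : R) q : quat R :=
  let: Quat a b c d := q in Quat (k * a) (k * b) (k * c) (k * d).

Definition qmul p q : quat R :=
  let: Quat a b c d := p in
  let: Quat a' b' c' d' := q in
  Quat (a * a' - b * b' - c * c' - d * d')
       (a * b' + b * a' + c * d' - d * c')
       (a * c' - b * d' + c * a' + d * b')
       (a * d' + b * c' - c * b' + d * a').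

Definition qsqnorm q : R :=
  let: Quat a b c d := q in a ^+ 2 + b ^+ 2 + c ^+ 2 + d ^+ 2.

Definition qnorm q : R := Num.sqrt (qsqnorm q).

Definition qconj q : quat R :=
  let: Quat a b c d := q in Quat a (- b) (- c) (- d).

Definition qinv q : quat R := qscale (qsqnorm q)^-1 (qconj q).

Fact qaddA : associative qadd.
Proof. by case=> a b c d [a1 b1 c1 d1] [a2 b2 c2 d2] /=; rewrite !addrA. Qed.

Fact qaddC : commutative qadd.
Proof. by case=> a b c d [a1 b1 c1 d1] /=; congr Quat; exact: addrC. Qed.

Fact qadd0 : left_id qzero qadd.
Proof. by case=> a b c d /=; rewrite !add0r. Qed.

Fact qaddN : left_inverse qzero qopp qadd.
Proof. by case=> a b c d /=; rewrite !addNr. Qed.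

HB.instance Definition _ :=
  GRing.isZmodule.Build (quat R) qaddA qaddC qadd0 qaddN.

Fact qscaleA (k l : R) q : qscale k (qscale l q) = qscale (k * l) q.
Proof. by case: q => a b c d /=; rewrite !mulrA. Qed.

Fact qscale1 : left_id 1 qscale.
Proof. by case=> a b c d /=; rewrite !mul1r. Qed.

Fact qscaleDr : right_distributive qscale +%R.
Proof. by move=> k [a b c d] [a1 b1 c1 d1]; congr Quat; exact: mulrDr. Qed.

Fact qscaleDl q : {morph qscale^~ q : k l / k + l}.
Proof. by case: q => a b c d k l; congr Quat; exact: mulrDl. Qed.

HB.instance Definition _ := GRing.Zmodule_isLmodule.Build R (quat R)
  qscaleA qscale1 qscaleDr qscaleDl.

Fact qsqnorm_ge0 q : 0 <= qsqnorm q.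
Proof. by case: q => a b c d; rewrite /= !addr_ge0 ?sqr_ge0. Qed.

Fact qsqnorm_eq0 q : qsqnorm q = 0 -> q = 0.
Proof.
case: q => a b c d /= /eqP; rewrite !paddr_eq0 ?addr_ge0 ?sqr_ge0 // !sqrf_eq0.
by move=> /andP[/andP[/andP[/eqP-> /eqP->] /eqP->] /eqP->].
Qed.

Fact qnormD p q : qnorm (p + q) <= qnorm p + qnorm q.
Proof.
rewrite -ler_sqr ?nnegrE ?addr_ge0 ?sqrtr_ge0 //.
rewrite sqrrD /qnorm !sqr_sqrtr ?qsqnorm_ge0 // -sqrtrM ?qsqnorm_ge0 //.
case: p q => [a b c d] [a1 b1 c1 d1].
set P := Quat a b c d; set Q := Quat a1 b1 c1 d1.
pose s := a * a1 + b * b1 + c * c1 + d * d1.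
have -> : qsqnorm (P + Q) = qsqnorm P + s *+ 2 + qsqnorm Q.
  by rewrite /s /=; ring.
rewrite lerD2r lerD2l lerMn2r /=; apply: le_trans (ler_norm _) _.
rewrite -sqrtr_sqr ler_wsqrtr // -subr_ge0.
have -> : qsqnorm P * qsqnorm Q - s ^+ 2 =
    (a * b1 - b * a1) ^+ 2 + (a * c1 - c * a1) ^+ 2 + (a * d1 - d * a1) ^+ 2 +
    (b * c1 - c * b1) ^+ 2 + (b * d1 - d * b1) ^+ 2 + (c * d1 - d * c1) ^+ 2.
  by rewrite /s /=; ring.
by rewrite !addr_ge0 ?sqr_ge0.
Qed.

Fact qnormZ (k : R) q : qnorm (k *: q) = `|k| * qnorm q.
Proof.
rewrite -sqrtr_sqr -sqrtrM ?sqr_ge0 //; congr Num.sqrt.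
by case: q => a b c d /=; ring.
Qed.

Fact qnorm_eq0 q : qnorm q = 0 -> q = 0.
Proof.
move/eqP; rewrite sqrtr_eq0 => q0; apply: qsqnorm_eq0; apply/eqP.
by rewrite eq_le q0 qsqnorm_ge0.
Qed.

HB.instance Definition _ := Lmodule_isNormed.Build R (quat R)
  qnormD qnormZ qnorm_eq0.

Fact qmulA : associative qmul.
Proof.
by case=> a b c d [a1 b1 c1 d1] [a2 b2 c2 d2]; congr Quat; rewrite /=; ring.
Qed.

Fact qmul1l : left_id qone qmul.
Proof. by case=> a b c d; congr Quat; rewrite /=; ring. Qed.

Fact qmul1r : right_id qone qmul.
Proof. by case=> a b c d; congr Quat; rewrite /=; ring. Qed.

Fact qmulDl : left_distributive qmul +%R.
Proof.
by case=> a b c d [a1 b1 c1 d1] [a2 b2 c2 d2]; congr Quat; rewrite /=; ring.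
Qed.

Fact qmulDr : right_distributive qmul +%R.
Proof.
by case=> a b c d [a1 b1 c1 d1] [a2 b2 c2 d2]; congr Quat; rewrite /=; ring.
Qed.

Fact qone_neq0 : qone != 0.
Proof. by apply/eqP => -[] /eqP; rewrite oner_eq0. Qed.

HB.instance Definition _ := GRing.Zmodule_isNzRing.Build (quat R)
  qmulA qmul1l qmul1r qmulDl qmulDr qone_neq0.

Fact qscaleAl (k : R) p q : k *: (p * q) = (k *: p) * q.
Proof.
by case: p q => [a b c d] [a1 b1 c1 d1]; congr Quat; rewrite /=; ring.
Qed.

HB.instance Definition _ :=
  GRing.Lmodule_isLalgebra.Build R (quat R) qscaleAl.

Fact qscaleAr (k : R) p q : k *: (p * q) = p * (k *: q).
Proof.
by case: p q => [a b c d] [a1 b1 c1 d1]; congr Quat; rewrite /=; ring.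
Qed.

HB.instance Definition _ :=
  GRing.Lalgebra_isAlgebra.Build R (quat R) qscaleAr.

Fact qmulVl : {in [pred q : quat R | q != 0], left_inverse 1 qinv *%R}.
Proof.
move=> q qn0; have {qn0} : qsqnorm q != 0 by apply: contra_neq qn0 => /qsqnorm_eq0.
by case: q => a b c d /= n0; congr Quat; rewrite /=; field.
Qed.

Fact qmulVr : {in [pred q : quat R | q != 0], right_inverse 1 qinv *%R}.
Proof.
move=> q qn0; have {qn0} : qsqnorm q != 0 by apply: contra_neq qn0 => /qsqnorm_eq0.
by case: q => a b c d /= n0; congr Quat; rewrite /=; field.
Qed.

Fact qunitP p q : q * p = 1 /\ p * q = 1 -> p != 0.
Proof.
by move=> [+ _]; apply: contra_eq_neq => ->; rewrite mulr0 eq_sym oner_neq0.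
Qed.

Fact qinv_out : {in [predC [pred q : quat R | q != 0]], qinv =1 id}.
Proof.
move=> q; rewrite !inE negbK => /eqP ->.
by congr Quat; rewrite /= ?oppr0 mulr0.
Qed.

HB.instance Definition _ := GRing.NzRing_hasMulInverse.Build (quat R)
  qmulVl qmulVr qunitP qinv_out.

(* In the algebra quat R, a%:A is the real quaternion a. *)
Definition qim q : quat R := q - (qre q)%:A.

End QuaternionAlgebra.

Section SliceGeometry.
Variable R : realType.
Implicit Types (Omega : set (quat R)) (I J : quat R).

Definition imag_units : set (quat R) := [set I | I * I = -1].

Definition slice_pt I (z : R * R) : quat R := z.1%:A + z.2 *: I.

Definition real_line : set (quat R) := [set a%:A | a in [set: R]].

Definition slice I : set (quat R) := [set slice_pt I z | z in [set: R * R]].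

Definition half_slice I : set (quat R) :=
  [set slice_pt I z | z in [set z : R * R | 0 <= z.2]].

Definition sphere_of (q : quat R) : set (quat R) :=
  [set (qre q)%:A + `|qim q| *: J | J in imag_units].

Definition circular Omega := forall q, Omega q -> sphere_of q `<=` Omega.

Definition circular_domain Omega :=
  [/\ Omega !=set0, open Omega, connected Omega & circular Omega].

Definition is_slice_domain Omega := Omega `&` real_line !=set0.

Definition is_product_domain Omega := Omega `&` real_line = set0.

(* A is a domain of the (relative) topological space C. *)
Definition domain_of (T : topologicalType) (C A : set T) :=
  [/\ A !=set0, connected A & exists2 U, open U & A = C `&` U].

(* Every loop in A is homotopic in A, with fixed base point, to a constant. *)
Definition null_homotopic_loops (T : topologicalType) (A : set T) :=
  forall gamma : R -> T,
    {within `[0, 1], continuous gamma} ->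
    (forall t : R, t \in `[0, 1] -> A (gamma t)) ->
    gamma 0 = gamma 1 ->
    exists H : R * R -> T,
      [/\ {within `[0, 1] `*` `[0, 1], continuous H},
          forall s t : R, s \in `[0, 1] -> t \in `[0, 1] -> A (H (s, t)),
          forall t : R, t \in `[0, 1] -> H (0, t) = gamma t,
          forall t : R, t \in `[0, 1] -> H (1, t) = gamma 0 &
          forall s : R, s \in `[0, 1] -> H (s, 0) = gamma 0 /\ H (s, 1) = gamma 0].

Definition simply_connected_domain_of (T : topologicalType) (C A : set T) :=
  domain_of C A /\ null_homotopic_loops A.

Definition slice_contractible Omega :=
  exists2 I, imag_units I &
    (is_slice_domain Omega ->
       simply_connected_domain_of (slice I) (Omega `&` slice I)) /\
    (is_product_domain Omega ->
       simply_connected_domain_of (slice I) (Omega `&` half_slice I)).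

End SliceGeometry.

Section SliceRegular.
Variable R : realType.
Implicit Types (Omega : set (quat R)) (f g : quat R -> quat R).

(* The complex plane of the variable of F_0 and F_1 is R * R. *)
Definition stem_domain Omega : set (R * R) :=
  [set z | exists2 I, imag_units I & Omega (slice_pt I z)].

Definition cconj (z : R * R) : R * R := (z.1, - z.2).

Definition dalpha (F : R * R -> quat R) (z : R * R) : quat R := 'D_(1, 0) F z.

Definition dbeta (F : R * R -> quat R) (z : R * R) : quat R := 'D_(0, 1) F z.

(* Meant for open D. *)
Definition C1_on (D : set (R * R)) (F : R * R -> quat R) :=
  forall z, D z ->
    [/\ derivable F z (1, 0), derivable F z (0, 1),
        {for z, continuous (dalpha F)} & {for z, continuous (dbeta F)}].

(* Functions on Omega are represented by total functions, of which only the
   values on Omega matter. *)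
Definition slice_regular Omega f :=
  exists F0 F1 : R * R -> quat R,
    [/\ C1_on (stem_domain Omega) F0,
        C1_on (stem_domain Omega) F1,
        forall z, stem_domain Omega z ->
          F0 (cconj z) = F0 z /\ F1 (cconj z) = - F1 z,
        forall z, stem_domain Omega z ->
          dalpha F0 z = dbeta F1 z /\ dbeta F0 z = - dalpha F1 z &
        forall I z, imag_units I -> Omega (slice_pt I z) ->
          f (slice_pt I z) = F0 z + I * F1 z].

Definition preserves_slice Omega f (I : quat R) :=
  f @` (Omega `&` slice I) `<=` slice I.

Definition slice_preserving Omega f :=
  forall I, imag_units I -> preserves_slice Omega f I.

Definition star_mul f g (q : quat R) : quat R :=
  if f q == 0 then 0 else f q * g ((f q)^-1 * q * f q).

Fixpoint star_pow f (n : nat) : quat R -> quat R :=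
  if n is n'.+1 then star_mul f (star_pow f n') else fun=> 1.

(* exp_*(f) = g on Omega: the exponential series converges pointwise to g. *)
Definition exp_star_eq Omega f g :=
  forall q, Omega q ->
    series (fun n => (n`!%:R : R)^-1 *: star_pow f n q) @ \oo --> g q.

Definition star_log Omega g f :=
  slice_regular Omega f /\ exp_star_eq Omega f g.

End SliceRegular.

(* Main.v *)
Require Import Defs.
From mathcomp Require Import all_boot all_order all_algebra.
From mathcomp Require Import ring lra.
From mathcomp Require Import all_classical all_reals all_analysis.

(** Write D for the plane domain of the stem functions and fix an imaginary
unit I with g preserving the slice of I.  On that slice g is an ordinary
holomorphic function h = G0 + I G1 of z in D with values in the complex plane
of I, without zeros.  So the theorem is about complex logarithms: a logarithm
l of h on D extends to the slice regular function f with stem components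
F0 z = (l z + l (conj z)) / 2 and F1 z = - I (l z - l (conj z)) / 2, and f is a
star logarithm of g.

The last claim holds because star powers are computed separately at z and at
conj z.  With u = F0 + I F1 and v = F0 - I F1, the value of f at alpha + J beta
is (1 - J I) / 2 * u + (1 + J I) / 2 * v, and [star_pow_slice] shows that the
n-th star power is obtained by replacing u and v by u^n and v^n: conjugating
the variable by the value c of f is exactly what moves c past these two
factors.  Hence the star exponential is given by the same formula with exp u
and exp v ([star_exp_slice]), where the exponential series in a slice is summed
to its polar form by a Taylor estimate ([exp_remainder]).

The existence of l reduces to a continuous argument th of h ([continuous_arg]),
the real part being the logarithm of the modulus.  The argument is continued
along paths; two paths with the same endpoints give the same value because a
null homotopy can itself be lifted: on a compact set one lifts by adding up
finitely many turns of less than a right angle ([compact_lift]), and three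
sides of the square of the homotopy are mapped to a point.  A continuous
argument is automatically continuously differentiable and satisfies the
Cauchy-Riemann equations together with the logarithm of the modulus, since
locally it is a constant plus an arctangent ([has_partials_logarithm]).

For a slice domain D itself is simply connected.  For a product domain D has
two halves exchanged by conjugation, and the arguments on them are chosen
independently ([glue_arg]).  If g is slice preserving then h (conj z) is the
conjugate of h z, and f is slice preserving as soon as th is odd under
conjugation.  On a product domain oddness is imposed by the choice on the
lower half.  On a slice domain with g positive at a real point x0, one takes
th x0 = 0; then th z + th (conj z) is a continuous multiple of 2 pi vanishing
at x0, hence zero ([cos1_constant]).  The same rigidity gives uniqueness: the
stem of a slice preserving logarithm is made of the logarithm of the modulus
and of an odd continuous argument, which vanishes at x0. *)

Set Implicit Arguments.
Unset Strict Implicit.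
Unset Printing Implicit Defensive.

Import Order.TTheory GRing.Theory Num.Theory.
Import numFieldNormedType.Exports.

Local Open Scope classical_set_scope.
Local Open Scope ring_scope.

(** * Arguments of plane vectors *)

Section Angles.
Variable R : realType.
Implicit Types (w : R * R) (t u : R).

Definition is_arg w t := exists2 m, 0 < m & w = (m * cos t, m * sin t).

Definition dot w w' := w.1 * w'.1 + w.2 * w'.2.

Definition cross w w' := w.1 * w'.2 - w.2 * w'.1.

(** The arctangent gives the signed angle from w to w' only when that angle
is acute, that is when [0 < dot w w']. *)
Definition turn w w' := atan (cross w w' / dot w w').

Lemma dot_gt0 w : w != (0, 0) -> 0 < dot w w.
Proof.
case: w => a b; rewrite xpair_eqE negb_and /dot /= => ab0.
rewrite lt_def addr_ge0 ?sqr_ge0 ?andbT -?expr2 ?sqr_ge0 //.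
by rewrite paddr_eq0 ?sqr_ge0 // !sqrf_eq0 negb_and.
Qed.

Lemma turn_id w : turn w w = 0.
Proof. by rewrite /turn /cross [w.2 * _]mulrC subrr mul0r atan0. Qed.

(** Up to positive factors, [dot w w'] and [cross w w'] are the coordinates of w'
in the frame rotated by t, so the angle a from w to w' has
tan a = cross w w' / dot w w'; it is the arctangent because cos a > 0. *)
Lemma is_arg_turn w w' t :
  is_arg w t -> 0 < dot w w' -> is_arg w' (t + turn w w').
Proof.
case=> m m0 -> {w}; set w := (_, _) => dot0.
set a := turn w w'.
have a_lt : a < pi / 2 := atan_ltpi2 _.
have a_gt : - (pi / 2) < a := atan_gtNpi2 _.
have ca : 0 < cos a by apply: cos_gt0_pihalf; rewrite a_gt a_lt.
have cr : cross w w' = dot w w' * (sin a / cos a).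
  by rewrite -[sin a / cos a]/(tan a) /a atanK mulrC divfK // gt_eqF.
exists (dot w w' / cos a / m); first by rewrite !divr_gt0.
have t1 := cos2Dsin2 t.
(* The coordinates of w' in the frame rotated by t, rotated back. *)
have E1 : m * w'.1 = cos t * dot w w' - sin t * cross w w'.
  by rewrite /dot /cross /w /= -[LHS]mulr1 -t1; ring.
have E2 : m * w'.2 = sin t * dot w w' + cos t * cross w w'.
  by rewrite /dot /cross /w /= -[LHS]mulr1 -t1; ring.
have mn0 : m != 0 by rewrite gt_eqF.
have cn0 : cos a != 0 by rewrite gt_eqF.
rewrite [LHS]surjective_pairing cosD sinD; congr pair; apply: (mulfI mn0).
  by rewrite E1 cr; field; rewrite mn0 cn0.
by rewrite E2 cr; field; rewrite mn0 cn0.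
Qed.

(** One of the four unit vectors of the axes makes an acute angle with w, and
its argument is known. *)
Lemma ex_arg w : w != (0, 0) -> exists t, is_arg w t.
Proof.
move=> w0.
have [a|a|a] := ltgtP 0 w.1.
- exists (0 + turn (1, 0) w); apply: is_arg_turn; last by rewrite /dot /=; lra.
  by exists 1; rewrite ?ltr01 // cos0 sin0 !mul1r.
- exists (pi + turn (-1, 0) w); apply: is_arg_turn; last by rewrite /dot /=; lra.
  by exists 1; rewrite ?ltr01 // cospi sinpi !mul1r.
- have b0 : w.2 != 0 by apply: contraNneq w0 => b0; case: (w) a b0 => /= ? ? <- ->.
  have [b|b|b] := ltgtP 0 w.2; last by rewrite b eqxx in b0.
    exists (pi / 2 + turn (0, 1) w); apply: is_arg_turn; last by rewrite /dot /=; lra.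
    by exists 1; rewrite ?ltr01 // cos_pihalf sin_pihalf !mul1r.
  exists (- (pi / 2) + turn (0, -1) w); apply: is_arg_turn; last by rewrite /dot /=; lra.
  by exists 1; rewrite ?ltr01 // cosN sinN cos_pihalf sin_pihalf !mul1r.
Qed.

(** The two equations say that t - u is a multiple of 2 pi without naming the
integer, which is the form that passes through continuity arguments. *)
Lemma is_arg_cos_sinB w t u : is_arg w t -> is_arg w u ->
  cos (t - u) = 1 /\ sin (t - u) = 0.
Proof.
move=> [m m0 ->] [n n0 [e1 e2]].
have ct := cos2Dsin2 t; have cu := cos2Dsin2 u.
have mn : m = n.
  apply/eqP; rewrite -(@eqrXn2 _ 2) ?ltW //; apply/eqP.
  rewrite -[LHS]mulr1 -[RHS]mulr1 -{1}ct -cu !mulrDr -!exprMn.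
  by rewrite e1 e2.
move: e1 e2; rewrite -mn => /(mulfI (lt0r_neq0 m0)) e1 /(mulfI (lt0r_neq0 m0)) e2.
by rewrite cosB sinB e1 e2 -cu; split; ring.
Qed.

Lemma is_argD w t u : is_arg w t -> cos u = 1 -> sin u = 0 -> is_arg w (t + u).
Proof.
move=> [m m0 ->] cu su; exists m => //.
by rewrite cosD sinD cu su !mulr1 !mulr0 subr0 addr0.
Qed.

Lemma is_arg_conj w t : is_arg w t -> is_arg (w.1, - w.2) (- t).
Proof. by move=> [m m0 ->]; exists m; rewrite //= cosN sinN mulrN. Qed.

(** A continuous function with values in the multiples of 2 pi is constant on a
connected set: its image is an interval, and an interval with more than one
point contains two points at a distance between 0 and pi, where cos drops
below 1. *)
Lemma cos1_constant (T : topologicalType) (S : set T) (d : T -> R) :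
  connected S -> {within S, continuous d} ->
  (forall x, S x -> cos (d x) = 1 /\ sin (d x) = 0) ->
  forall x y, S x -> S y -> d x = d y.
Proof.
move=> cS cd d1.
have key x y : S x -> S y -> ~ d x < d y.
  move=> Sx Sy xy.
  have /connected_intervalP itv := connected_continuous_connected cS cd.
  (* The interval between d x and d y contains d x + e with 0 < e <= pi. *)
  pose e := Num.min (d y - d x) pi.
  have e0 : 0 < e by rewrite lt_min subr_gt0 xy pi_gt0.
  have epi : e <= pi by rewrite ge_min lexx orbT.
  have [z Sz dz] : [set d x | x in S] (d x + e).
    apply: (itv (d x) (d y)); [by exists x|by exists y|].
    rewrite lerDl (ltW e0) /=; have : e <= d y - d x by rewrite ge_min lexx.
    lra.
  have [cz sz] := d1 z Sz; have [cx sx] := d1 x Sx.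
  have ce : cos e = cos 0.
    by move: cz; rewrite dz cosD cx sx cos0; lra.
  have := cos_inj _ _ ce.
  rewrite !in_itv /= (ltW e0) epi lexx pi_ge0 => /(_ isT isT) E.
  by move: e0; rewrite E ltxx.
move=> x y Sx Sy; have [|/(key _ _ Sy Sx)//|//] := ltgtP (d x) (d y).
by move=> /(key _ _ Sx Sy).
Qed.

End Angles.

(** * Lifting the argument over a compact set *)

Section Lifting.
Variable R : realType.

Section Cvg.
Variables (T : Type) (F : set_system T).
Context {FF : Filter F}.
Implicit Types f g : T -> R * R.

Lemma cvg_fst_comp (U V : topologicalType) (f : T -> U * V) (w : U * V) :
  f @ F --> w -> (fun x => (f x).1) @ F --> w.1.
Proof. by move=> fw; apply: (@cvg_comp _ _ _ f fst _ _ _ fw); case: w {fw} => a b; exact: cvg_fst. Qed.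

Lemma cvg_snd_comp (U V : topologicalType) (f : T -> U * V) (w : U * V) :
  f @ F --> w -> (fun x => (f x).2) @ F --> w.2.
Proof. by move=> fw; apply: (@cvg_comp _ _ _ f snd _ _ _ fw); case: w {fw} => a b; exact: cvg_snd. Qed.

Lemma cvg_pair_comp (U V : topologicalType) (f : T -> U) (g : T -> V) (a : U) (b : V) :
  f @ F --> a -> g @ F --> b -> (fun x => (f x, g x)) @ F --> (a, b).
Proof. by move=> fa gb; exact: cvg_pair. Qed.

Lemma cvg_dot f g (w w' : R * R) : f @ F --> w -> g @ F --> w' ->
  dot (f x) (g x) @[x --> F] --> dot w w'.
Proof.
move=> fw gw; apply: cvgD; apply: cvgM;
  by [exact: cvg_fst_comp|exact: cvg_snd_comp].
Qed.

Lemma cvg_cross f g (w w' : R * R) : f @ F --> w -> g @ F --> w' ->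
  cross (f x) (g x) @[x --> F] --> cross w w'.
Proof.
move=> fw gw; apply: cvgB; apply: cvgM;
  by [exact: cvg_fst_comp|exact: cvg_snd_comp].
Qed.

Lemma cvg_turn f g (w w' : R * R) : f @ F --> w -> g @ F --> w' -> 0 < dot w w' ->
  turn (f x) (g x) @[x --> F] --> turn w w'.
Proof.
move=> fw gw w0; rewrite /turn.
apply: (@cvg_comp _ _ _ (fun x => cross (f x) (g x) / dot (f x) (g x)) atan);
  last exact: continuous_atan.
apply: cvgM; first exact: cvg_cross.
by apply: cvgV; [rewrite gt_eqF|exact: cvg_dot].
Qed.

End Cvg.

Lemma continuous_fst (U V : topologicalType) : continuous (@fst U V).
Proof. by move=> [a b]; exact: cvg_fst. Qed.

Lemma continuous_snd (U V : topologicalType) : continuous (@snd U V).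
Proof. by move=> [a b]; exact: cvg_snd. Qed.

(** Uniform continuity in the form needed for lifting: along every ray through a
point of K, steps of parameter length at most 1 / (n + 1) turn k by less than
a right angle.  The step is uniform by a covering argument on [0, 1] * K. *)
Lemma compact_dot_gt0 (V : normedModType R) (K : set V) (k : V -> R * R) :
  compact K -> continuous k -> (forall x, k x != (0, 0)) ->
  exists n, forall x s t, K x -> s \in `[0, 1] -> `|s - t| <= n.+1%:R^-1 ->
    0 < dot (k (s *: x)) (k (t *: x)).
Proof.
move=> cK ck k0.
have cK1 : compact (`[0, 1]%classic `*` K : set (R * V)).
  by apply: compact_setX => //; exact: segment_compact.
pose P (n : nat) (y : R * V) := forall t, `|y.1 - t| <= n.+1%:R^-1 ->
  0 < dot (k (y.1 *: y.2)) (k (t *: y.2)).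
have [|N _ PN] := (compact_near_coveringP _).1 cK1 nat \oo P _.
  move=> [s x] _.
  (* At equal parameters d is the squared length of k, hence positive, and it
     stays positive nearby. *)
  pose d (y : (R * V) * R) := dot (k (y.1.1 *: y.1.2)) (k (y.2 *: y.1.2)).
  have : d y @[y --> ((s, x), s)] --> d ((s, x), s).
    have y1 : (fun y : (R * V) * R => y.1) @ ((s, x), s) --> (s, x).
      exact: cvg_fst.
    have y2 : (fun y : (R * V) * R => y.2) @ ((s, x), s) --> s.
      exact: cvg_snd.
    have y12 := cvg_snd_comp y1.
    apply: cvg_dot; (apply: (@cvg_comp _ _ _ _ k); last exact: ck).
      by apply: cvgZ => //; exact: cvg_fst_comp y1.
    exact: cvgZ.
  move=> /(_ [set r | 0 < r]) /= H.
  have {}/H : nbhs (d (s, x, s)) [set r : R | 0 < r].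
    apply: (lt_nbhsr (dot_gt0 (k0 _))).
  rewrite nbhs_simpl => -[[A B]] /= [nA nB] AB.
  have [e /= e0 eB] := (nbhs_ballP _ _).1 nB.
  have e2 : 0 < e / 2 by rewrite divr_gt0.
  have nA' : nbhs (s, x) (A `&` [set y | ball s (e / 2) y.1]).
    apply: filterI => //.
    have : (fun y : R * V => y.1) @ (s, x) --> s.
      exact: cvg_fst.
    by apply; exact: nbhsx_ballx.
  exists (A `&` [set y | ball s (e / 2) y.1], [set n | n.+1%:R^-1 < e / 2]) => /=.
    by split => //; exact: (near_infty_natSinv_lt (PosNum e2)).
  move=> [y n] /= [[Ay yB] nB'] t yt.
  apply: (AB (y, t)); split => //=; apply: eB.
  rewrite [e]splitr.
  apply: ball_triangle yB _; apply: le_lt_trans yt _ => //.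
have := PN N (leqnn N).
move=> H; exists N => x s t Kx s01 st.
by apply: (H (s, x)) => //; split => //=; rewrite ?set_itvE.
Qed.

(** Walk from 0 to x in n + 1 equal steps and add up the turns of k: every
partial sum is an argument at the current point and is continuous in x.  The
walk may leave K, hence a map k defined on the whole space. *)
Lemma compact_lift (V : normedModType R) (K : set V) (k : V -> R * R) :
  compact K -> continuous k -> (forall x, k x != (0, 0)) ->
  exists Th : V -> R, forall x, K x -> is_arg (k x) (Th x) /\ {for x, continuous Th}.
Proof.
move=> cK ck k0; have [n Hn] := compact_dot_gt0 cK ck k0.
have [t0 Ht0] := ex_arg (k0 0).
(* The recursion below counts steps: Th m is an argument of k at (c m) x. *)
pose c (m : nat) : R := m%:R / n.+1%:R.
pose Th := fix Th (m : nat) x := if m is j.+1 then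
  Th j x + turn (k (c j *: x)) (k (c j.+1 *: x)) else t0.
have dotp m x : (m < n.+1)%N -> K x -> 0 < dot (k (c m *: x)) (k (c m.+1 *: x)).
  move=> mn Kx; apply: Hn => //.
    by rewrite in_itv /= divr_ge0 //= ler_pdivrMr // mul1r ler_nat ltnW.
  rewrite distrC -mulrBl -natrB // subSnn mul1r ger0_norm //.
have H m : (m <= n.+1)%N -> forall x, K x ->
    is_arg (k (c m *: x)) (Th m x) /\ {for x, continuous (Th m)}.
  elim: m => [_ x Kx|m IH mn x Kx].
    by rewrite /c mul0r scale0r; split => //; exact: cvg_cst.
  have [H1 H2] := IH (ltnW mn) x Kx.
  have := dotp m x mn Kx => dp.
  split; first exact: is_arg_turn.
  apply: cvgD => //; apply: cvg_turn => //;
    (apply: (@cvg_comp _ _ _ _ k); last exact: ck);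
    by apply: cvgZr_tmp || apply: cvgZl_tmp || apply: scaler_continuous.
exists (Th n.+1) => x Kx; have [] := H n.+1 (leqnn _) x Kx.
by rewrite /c divff ?scale1r // pnatr_eq0.
Qed.

End Lifting.

(** * A continuous argument on a simply connected plane domain *)

Section Clamp.
Variable R : realType.

(** Precomposition with [clamp] turns paths and homotopies parametrised by
[0, 1] into total continuous maps.  It also makes concatenation a sum: g1
followed by g2 is g1 (clamp (2 t)) + (g2 (clamp (2 t - 1)) - g2 0), in which
one of the two terms is frozen on each half of [0, 1]. *)
Definition clamp (t : R) : R := Num.max 0 (Num.min t 1).

Lemma clamp01 t : clamp t \in `[0, 1].
Proof. by rewrite in_itv /= /clamp le_max lexx /= ge_max ler01 ge_min lexx orbT. Qed.

Lemma clamp_id t : t \in `[0, 1] -> clamp t = t.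
Proof. by rewrite in_itv /= => /andP[t0 t1]; rewrite /clamp min_l // max_r. Qed.

Lemma clamp_le0 t : t <= 0 -> clamp t = 0.
Proof. by move=> t0; rewrite /clamp max_l // ge_min t0. Qed.

Lemma clamp_ge1 t : 1 <= t -> clamp t = 1.
Proof. by move=> t1; rewrite /clamp min_r // max_r. Qed.

Lemma continuous_clamp : continuous clamp.
Proof.
move=> t; have m1 : {for t, continuous ((id : R -> R^o) \min (cst 1 : R -> R^o))}.
  by apply: continuous_min; [exact: cvg_id|exact: cvg_cst].
have := @continuous_max R R (cst 0) _ t (@cvg_cst _ _ _ _ _) m1.
by move=> H; exact: H.
Qed.

Lemma continuous_clamp_affine (a b : R) : continuous (fun t => clamp (a * t + b)).
Proof.
move=> t; apply: (@cvg_comp _ _ _ (fun t => a * t + b) clamp);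
  last exact: continuous_clamp.
by apply: cvgD; [apply: cvgMl_tmp; exact: cvg_id|exact: cvg_cst].
Qed.

Lemma in01_0 : (0 : R) \in `[0, 1].
Proof. by rewrite in_itv /= lexx ler01. Qed.

Lemma in01_1 : (1 : R) \in `[0, 1].
Proof. by rewrite in_itv /= lexx ler01. Qed.

End Clamp.

Section Covering.
Variables (R : realType) (D : set (R * R)) (h : R * R -> R * R).
Hypothesis D_open : open D.
Hypothesis D_conn : connected D.
Hypothesis D_null : @null_homotopic_loops R (R * R)%type D.
Hypothesis h_cont : forall z, D z -> {for z, continuous h}.
Hypothesis h_neq0 : forall z, D z -> h z != (0, 0).

(** Lift h along a null homotopy of the loop g.  The homotopy is constant on
three sides of the square, so the lift takes the same value at the four
corners; on the remaining side the lift and psi differ by a constant. *)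
Lemma monodromy (g : R -> R * R) (psi : R -> R) :
  continuous g -> (forall t, D (g t)) -> g 0 = g 1 -> continuous psi ->
  (forall t, is_arg (h (g t)) (psi t)) -> psi 0 = psi 1.
Proof.
move=> cg Dg g01 cpsi argpsi.
have [H [cH DH H0 H1 Hs]] := D_null (continuous_subspaceT cg) (fun t _ => Dg t) g01.
pose H' (y : R * R) := H (clamp y.1, clamp y.2).
have DH' y : D (H' y) by apply: DH; exact: clamp01.
have cH' : continuous H'.
  move=> y U nU.
  have Ky : (`[0, 1] `*` `[0, 1])%classic (clamp y.1, clamp y.2).
    by split; exact: clamp01.
  have /= /(_ _ nU) := (subspace_continuousP _ _).1 cH _ Ky.
  rewrite nbhs_simpl /= /within /= => nH.
  have cc : (fun y : R * R => (clamp y.1, clamp y.2)) @ y -->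
      (clamp y.1, clamp y.2).
    apply: cvg_pair_comp.
      apply: (@continuous_comp _ _ _ (@fst R R) (@clamp R) y); last exact: continuous_clamp.
      exact: continuous_fst.
    apply: (@continuous_comp _ _ _ (@snd R R) (@clamp R) y); last exact: continuous_clamp.
      exact: continuous_snd.
  have {}nH : nbhs y [set z | U (H' z)]; last exact: nH.
  apply: (@filterS _ (nbhs y) _ _ _ _ (cc _ nH)) => z /=; apply.
  by split; exact: clamp01.
pose K : set (R * R) := `[0, 1] `*` `[0, 1].
have cK : compact K by apply: compact_setX; exact: segment_compact.
have ck : continuous (h \o H').
  by move=> y; apply: continuous_comp; [exact: cH'|exact: h_cont].
have k0 y : (h \o H') y != (0, 0) by exact: h_neq0.
have [Th HTh] := compact_lift cK ck k0.
(* Along a path p in the square, the lift Th and any continuous argument e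
   of the same values differ by a constant. *)
have edge (p : R -> R * R) (e : R -> R) : continuous p -> continuous e ->
    (forall t, t \in `[0, 1] -> K (p t)) ->
    (forall t, t \in `[0, 1] -> is_arg (h (H' (p t))) (e t)) ->
    Th (p 0) - e 0 = Th (p 1) - e 1.
  move=> cp ce Kp arge.
  apply: (@cos1_constant R R `[0, 1]%classic (fun t => Th (p t) - e t) _ _ _ 0 1).
  - exact: segment_connected.
  - apply: continuous_in_subspaceT => t /set_mem t01; apply: cvgB; last exact: ce.
    by apply: continuous_comp; [exact: cp|exact: (HTh _ (Kp _ t01)).2].
  - move=> t t01; apply: (@is_arg_cos_sinB _ (h (H' (p t)))); last exact: arge.
    exact: (HTh _ (Kp _ t01)).1.
  - exact: in01_0.
  - exact: in01_1.
have i0 := in01_0 R; have i1 := in01_1 R.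
have K00 : K (0, 0) by split.
have cl (u : R) : u \in `[0, 1] -> continuous (fun t : R => (u, t)) /\
  continuous (fun t : R => (t, u)).
  by move=> _; split=> ?; apply: cvg_pair_comp; try exact: cvg_cst; exact: cvg_id.
have arg00 : is_arg (h (g 0)) (Th (0, 0)).
  by have := (HTh _ K00).1; rewrite /= /H' /= clamp_id // H0.
have E1 := edge (fun t => (0, t)) psi (cl 0 i0).1 cpsi.
have E2 := edge (fun t => (t, 0)) (cst (Th (0, 0))) (cl 0 i0).2 (@cst_continuous _ _ _).
have E3 := edge (fun t => (1, t)) (cst (Th (0, 0))) (cl 1 i1).1 (@cst_continuous _ _ _).
have E4 := edge (fun t => (t, 1)) (cst (Th (0, 0))) (cl 1 i1).2 (@cst_continuous _ _ _).
have {}E1 : Th (0, 0) - psi 0 = Th (0, 1) - psi 1.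
  apply: E1 => t t01; first by split.
  by rewrite /H' /= !clamp_id // H0.
have {}E2 : Th (0, 0) - Th (0, 0) = Th (1, 0) - Th (0, 0).
  apply: E2 => t t01; first by split.
  by rewrite /H' /= !clamp_id // (Hs _ t01).1.
have {}E3 : Th (1, 0) - Th (0, 0) = Th (1, 1) - Th (0, 0).
  apply: E3 => t t01; first by split.
  by rewrite /H' /= !clamp_id // H1.
have {}E4 : Th (0, 1) - Th (0, 0) = Th (1, 1) - Th (0, 0).
  apply: E4 => t t01; first by split.
  by rewrite /H' /= !clamp_id // (Hs _ t01).2.
lra.
Qed.

Variables (x0 : R * R) (t0 : R).
Hypothesis Dx0 : D x0.
Hypothesis argx0 : is_arg (h x0) t0.

(** v is the argument at x obtained by continuation of the argument t0 at x0
along some path in D. *)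
Definition lifted (x : R * R) (v : R) :=
  exists (g : R -> R * R) (phi : R -> R),
    [/\ continuous g /\ continuous phi, forall t, D (g t),
        forall t, is_arg (h (g t)) (phi t), g 0 = x0 /\ phi 0 = t0
      & g 1 = x /\ phi 1 = v].

Lemma lifted_arg x v : lifted x v -> D x /\ is_arg (h x) v.
Proof. by move=> [g [phi [_ Dg ag _ [<- <-]]]]. Qed.

(** Following one path forth and the other one back makes a loop, on which the
two arguments combine into one by shifting the second by the multiple
v - w of 2 pi. *)
Lemma lifted_uniq x v w : lifted x v -> lifted x w -> v = w.
Proof.
move=> [g1 [f1 [[cg1 cf1] Dg1 ag1 [g10 f10] [g11 f11]]]].
move=> [g2 [f2 [[cg2 cf2] Dg2 ag2 [g20 f20] [g21 f21]]]].
have [cvw svw] : cos (v - w) = 1 /\ sin (v - w) = 0.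
  by apply: (@is_arg_cos_sinB _ (h x)); rewrite -?f11 -?f21 -?g11 // g11 -g21.
pose c1 (t : R) := clamp (2 * t + 0); pose c2 (t : R) := clamp ((-2) * t + 2).
(* g runs through g1 and then through g2 backwards. *)
pose g t := g1 (c1 t) + (g2 (c2 t) - x).
pose psi t := f1 (c1 t) + (f2 (c2 t) - w).
have cc1 : continuous c1 by exact: continuous_clamp_affine.
have cc2 : continuous c2 by exact: continuous_clamp_affine.
have halves (t : R) : g t = g1 (c1 t) /\ psi t = f1 (c1 t) \/
    g t = g2 (c2 t) /\ psi t = f2 (c2 t) + (v - w).
  rewrite /g /psi; have [t2|t2] := lerP t (2^-1).
    left; have -> : c2 t = 1 by rewrite /c2 clamp_ge1 //; lra.
    by rewrite g21 f21 !subrr !addr0.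
  right; have -> : c1 t = 1 by rewrite /c1 clamp_ge1 //; lra.
  by rewrite g11 f11 addrC subrK; split => //; ring.
have c10 : c1 0 = 0 by rewrite /c1 clamp_le0 //; lra.
have c11 : c1 1 = 1 by rewrite /c1 clamp_ge1 //; lra.
have c20 : c2 0 = 1 by rewrite /c2 clamp_ge1 //; lra.
have c21 : c2 1 = 0 by rewrite /c2 clamp_le0 //; lra.
have : psi 0 = psi 1.
  apply: (@monodromy g).
  - move=> t; apply: cvgD; last apply: cvgB; last exact: cvg_cst.
      by apply: (@cvg_comp _ _ _ c1 g1); [exact: cc1|exact: cg1].
    by apply: (@cvg_comp _ _ _ c2 g2); [exact: cc2|exact: cg2].
  - by move=> t; case: (halves t) => -[-> _].
  - by rewrite /g c10 c11 c20 c21 g10 g20 g11 g21 subrr addr0 addrC subrK.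
  - move=> t; apply: cvgD; last apply: cvgB; last exact: cvg_cst.
      by apply: (@cvg_comp _ _ _ c1 f1); [exact: cc1|exact: cf1].
    by apply: (@cvg_comp _ _ _ c2 f2); [exact: cc2|exact: cf2].
  - move=> t; case: (halves t) => -[-> ->] //.
    exact: is_argD.
rewrite /psi c10 c11 c20 c21 f10 f11 f20 f21; lra.
Qed.

(** In such a ball [turn (h y)] is a continuous branch of the argument, up to a
constant. *)
Lemma ex_small_ball x : D x -> exists2 e, 0 < e &
  forall y z, ball x e y -> ball x e z -> D y /\ 0 < dot (h y) (h z).
Proof.
move=> Dx.
have : dot (h y.1) (h y.2) @[y --> (x, x)] --> dot (h x) (h x).
  apply: cvg_dot; apply: (@cvg_comp _ _ _ _ h); try exact: h_cont.
    exact: cvg_fst.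
  exact: cvg_snd.
have n0 : nbhs (dot (h x) (h x)) [set r : R | 0 < r].
  exact: (lt_nbhsr (dot_gt0 (h_neq0 Dx))).
move=> /(_ _ n0); rewrite nbhs_simpl => -[[A B]] /= [nA nB] AB.
have nD : nbhs x D by exact: open_nbhs_nbhs.
have [e /= e0 eAB] := (nbhs_ballP _ _).1 (filterI nD (filterI nA nB)).
exists e => // y z /eAB [Dy [Ay _]] /eAB [_ [_ Bz]]; split => //.
exact: (AB (y, z)).
Qed.

(** The path is prolonged by the segment from y to z, which stays in the ball. *)
Lemma lifted_extend x e y z v :
  (forall y z, ball x e y -> ball x e z -> D y /\ 0 < dot (h y) (h z)) ->
  ball x e y -> ball x e z -> lifted y v -> lifted z (v + turn (h y) (h z)).
Proof.
move=> small By Bz [g1 [f1 [[cg1 cf1] Dg1 ag1 [g10 f10] [g11 f11]]]].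
pose c1 (t : R) := clamp (2 * t + 0); pose c2 (t : R) := clamp (2 * t + (-1)).
have cc1 : continuous c1 by exact: continuous_clamp_affine.
have cc2 : continuous c2 by exact: continuous_clamp_affine.
pose s (t : R) := y + t *: (z - y).
have cs : continuous s.
  move=> t; apply: cvgD; first exact: cvg_cst.
  by apply: cvgZr_tmp; exact: cvg_id.
have Bs t : t \in `[0, 1] -> ball x e (s t).
  rewrite in_itv /= => /andP[ti0 ti1].
  have -> : s t = (1 - t) *: y + t *: z.
    by rewrite /s scalerBr scalerBl scale1r addrA addrAC.
  move: By Bz; rewrite -ball_normE /= => By Bz.
  have -> : x - ((1 - t) *: y + t *: z) = (1 - t) *: (x - y) + t *: (x - z).
    by rewrite !scalerBr addrACA -opprD -scalerDl subrK scale1r.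
  apply: le_lt_trans (ler_normD _ _) _; rewrite !normrZ.
  rewrite (ger0_norm ti0) ger0_norm ?subr_ge0 //.
  have [->|tn0] := eqVneq t 0; first by rewrite subr0 mul1r mul0r addr0.
  have t_gt0 : 0 < t by rewrite lt_def tn0.
  have -> : e = (1 - t) * e + t * e by ring.
  apply: ler_ltD; last by rewrite ltr_pM2l.
  by rewrite ler_wpM2l ?subr_ge0 // ltW.
have s0 : s 0 = y by rewrite /s scale0r addr0.
have s1 : s 1 = z by rewrite /s scale1r addrC subrK.
(* g runs through g1 and then through the segment s from y to z. *)
pose g t := g1 (c1 t) + (s (c2 t) - y).
pose psi t := f1 (c1 t) + turn (h y) (h (s (c2 t))).
have halves (t : R) : g t = g1 (c1 t) /\ psi t = f1 (c1 t) \/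
    g t = s (c2 t) /\ psi t = v + turn (h y) (h (s (c2 t))).
  rewrite /g /psi; have [t2|t2] := lerP t (2^-1).
    left; have -> : c2 t = 0 by rewrite /c2 clamp_le0 //; lra.
    by rewrite s0 turn_id subrr !addr0.
  right; have -> : c1 t = 1 by rewrite /c1 clamp_ge1 //; lra.
  by rewrite g11 f11 addrC subrK.
have c10 : c1 0 = 0 by rewrite /c1 clamp_le0 //; lra.
have c11 : c1 1 = 1 by rewrite /c1 clamp_ge1 //; lra.
have c20 : c2 0 = 0 by rewrite /c2 clamp_le0 //; lra.
have c21 : c2 1 = 1 by rewrite /c2 clamp_ge1 //; lra.
have Bc t : ball x e (s (c2 t)) by apply: Bs; exact: clamp01.
have ay : is_arg (h y) v by rewrite -g11 -f11.
exists g, psi; split.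
- split=> t.
    apply: cvgD; last apply: cvgB; last exact: cvg_cst.
      by apply: (@cvg_comp _ _ _ c1 g1); [exact: cc1|exact: cg1].
    by apply: (@cvg_comp _ _ _ c2 s); [exact: cc2|exact: cs].
  apply: cvgD.
    by apply: (@cvg_comp _ _ _ c1 f1); [exact: cc1|exact: cf1].
  apply: cvg_turn; [exact: cvg_cst| |exact: (small _ _ By (Bc t)).2].
  apply: (@cvg_comp _ _ _ (s \o c2) h); last exact/h_cont/(small _ _ (Bc t) By).1.
  by apply: (@cvg_comp _ _ _ c2 s); [exact: cc2|exact: cs].
- by move=> t; case: (halves t) => -[-> _] //; exact: (small _ _ (Bc t) By).1.
- move=> t; case: (halves t) => -[-> ->] //.
  by apply: is_arg_turn => //; exact: (small _ _ By (Bc t)).2.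
- by rewrite /g /psi c10 c20 s0 turn_id subrr !addr0.
- by rewrite /g /psi c11 c21 s1 g11 f11 addrC subrK.
Qed.

(** Inside a small ball either all points are reached by continuation or none
is, so the points reached form a subset of D that is open and closed in D. *)
Lemma ex_lifted x : D x -> exists v, lifted x v.
Proof.
pose S := [set x | exists v, lifted x v].
have Slocal y : D y -> exists2 e, 0 < e &
    forall z w, ball y e z -> ball y e w -> D z /\ (S z -> S w).
  move=> Dy; have [e e0 small] := ex_small_ball Dy.
  exists e => // z w Bz Bw; split; first exact: (small z w Bz Bw).1.
  move=> [v lv]; exists (v + turn (h z) (h w)); exact: lifted_extend small Bz Bw lv.
suff -> : D = S by [].
(* The set S is tested against the definition of connectedness: it is the
   trace on D of an open set, and of the complement of D minus S. *)
apply/esym; apply: D_conn.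
- exists x0, t0; exists (cst x0), (cst t0); split=> //.
  by split; exact: cst_continuous.
- exists S.
    rewrite openE => y [v lv]; have [Dy _] := lifted_arg lv.
    have [e e0 He] := Slocal y Dy; apply/nbhs_ballP; exists e => //= z Bz.
    by apply: (He y z _ _).2 => //; [exact: ballxx|exists v].
  by apply/seteqP; split=> [y Sy|y []//]; split=> //; case: Sy => v /lifted_arg[].
- exists (~` (D `\` S)); last first.
    apply/seteqP; split=> [y Sy|y [Dy]].
      by split=> [|[]//]; case: Sy => v /lifted_arg[].
    by rewrite setDE setCI setCK => -[].
  apply: open_closedC; rewrite openE => y [Dy nSy].
  have [e e0 He] := Slocal y Dy; apply/nbhs_ballP; exists e => //=.
  move=> z Bz; split; first exact: (He z z Bz Bz).1.
  by move=> Sz; apply: nSy; apply: (He z y _ _).2 => //; exact: ballxx.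
Qed.

(** The argument obtained by continuation does not depend on the path, and near
z it equals th z + turn (h z) (h y), which is continuous in y. *)
Lemma continuous_arg : exists th : R * R -> R,
  [/\ forall z, D z -> {for z, continuous th}, forall z, D z -> is_arg (h z) (th z)
    & th x0 = t0].
Proof.
have [th Hth] : {th : R * R -> R & forall z, D z -> lifted z (th z)}.
  apply: (@choice _ _ (fun z v => D z -> lifted z v)) => z.
  by have [Dz|nDz] := pselect (D z); [have [v] := ex_lifted Dz; exists v|exists 0].
exists th; split.
- move=> z Dz; have [e e0 small] := ex_small_ball Dz.
  have Bz : ball z e z by exact: ballxx.
  have near_th : \forall y \near z, th z + turn (h z) (h y) = th y.
    apply/nbhs_ballP; exists e => //= y By; apply: (@lifted_uniq y).
      exact: lifted_extend small Bz By (Hth z Dz).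
    exact: Hth (small y z By Bz).1.
  have : th z + turn (h z) (h y) @[y --> z] --> th z + turn (h z) (h z).
    apply: cvgD; first exact: cvg_cst.
    apply: cvg_turn; [exact: cvg_cst|exact: h_cont|exact: (small z z Bz Bz).2].
  rewrite turn_id addr0; apply: cvg_trans; apply: near_eq_cvg.
  by apply: filterS near_th => y.
- by move=> z Dz; exact: (lifted_arg (Hth z Dz)).2.
- apply: (@lifted_uniq x0); first exact: Hth.
  by exists (cst x0), (cst t0); split=> //; split; exact: cst_continuous.
Qed.

End Covering.

Lemma ex_continuous_arg (R : realType) (P : set (R * R)) (k : R * R -> R * R) :
  P !=set0 -> open P -> connected P -> @null_homotopic_loops R (R * R)%type P ->
  (forall z, P z -> {for z, continuous k}) -> (forall z, P z -> k z != (0, 0)) ->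
  exists th : R * R -> R, forall z, P z -> {for z, continuous th} /\ is_arg (k z) (th z).
Proof.
move=> [z0 Pz0] oP cP nP kc k0; have [t0 arg0] := ex_arg (k0 z0 Pz0).
have [th [th_c th_a _]] := continuous_arg oP cP nP kc k0 Pz0 arg0.
by exists th => z Pz; split; [exact: th_c|exact: th_a].
Qed.

(** * Directional and partial derivatives *)

Section DirectionalDerivatives.
Variables (R : realType) (V W : normedModType R).

(** The chain rule and the mean value theorem are applied to functions of one
real variable, along the line through z in the direction v. *)
Lemma is_derive_lineP (f : V -> W) (z v : V) (d : W) :
  is_derive z v f d <-> is_derive (0 : R) 1 (fun t : R => f (t *: v + z)) d.
Proof.
have E : (fun t : R => t^-1 *: (f (t *: v + z) - f z)) =
  (fun t : R => t^-1 *: (f ((t *: (1 : R) + 0) *: v + z) - f (0 *: v + z))).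
  by apply/funext => t; rewrite addr0 scale0r add0r [_%:A]mulr1.
by split=> -[df dd]; split;
  move: df dd; rewrite /derivable /derive /= ?E // -?E.
Qed.

Lemma is_derive_linear (U : normedModType R) (L : W -> U) (f : V -> W) z v d :
  (forall k x y, L (k *: (x - y)) = k *: (L x - L y)) -> continuous L ->
  is_derive z v f d -> is_derive z v (L \o f) (L d).
Proof.
move=> linL cL [df fd].
have c : (fun h : R => h^-1 *: ((L \o f) (h *: v + z) - (L \o f) z)) @ 0^' --> L d.
  have : (fun h : R => h^-1 *: (f (h *: v + z) - f z)) @ 0^' --> d.
    by rewrite -fd.
  move=> fd'; under eq_fun do rewrite /= -linL.
  by apply: (cvg_comp _ _ fd'); exact: cL.
by split; [apply/cvg_ex; exists (L d)|exact: cvg_lim].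
Qed.

End DirectionalDerivatives.

Section RealDerivatives.
Variables (R : realType) (V : normedModType R).
Implicit Types (f : V -> R) (z v : V).

Lemma is_derive_oppv f z v (d : R) : is_derive z v f d -> is_derive z (- v) f (- d).
Proof.
move=> /is_derive_lineP df; apply/is_derive_lineP.
have -> : (fun t : R => f (t *: - v + z)) = (fun t => f (t *: v + z)) \o -%R.
  by apply/funext => t /=; rewrite scalerN scaleNr.
rewrite -mulrN1; apply: is_derive1_comp; by rewrite oppr0.
Qed.

Lemma is_derive_scalar_comp f z v (phi : R -> R) (a b : R) :
  is_derive (f z) 1 phi a -> is_derive z v f b -> is_derive z v (phi \o f) (a * b).
Proof.
move=> dphi /is_derive_lineP df; apply/is_derive_lineP.
apply: (@is_derive1_comp _ phi (fun t => f (t *: v + z))) => //.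
by rewrite scale0r add0r.
Qed.

Lemma is_derive_log_modulus (p r : V -> R) z v (dp dr : R) :
  0 < p z ^+ 2 + r z ^+ 2 -> is_derive z v p dp -> is_derive z v r dr ->
  is_derive z v (fun x => 2^-1 * ln (p x ^+ 2 + r x ^+ 2))
    ((p z * dp + r z * dr) / (p z ^+ 2 + r z ^+ 2)).
Proof.
move=> N0 hp hr.
have dN : is_derive z v (p * p + r * r) (2 * (p z * dp + r z * dr)).
  apply: is_derive_eq (is_deriveD (is_deriveM hp hp) (is_deriveM hr hr)) _.
  by rewrite -![_ *: _]/(_ * _); ring.
have dl : is_derive z v (@ln R \o (p * p + r * r)) ((p z ^+ 2 + r z ^+ 2)^-1 * (2 * (p z * dp + r z * dr))).
  apply: is_derive_scalar_comp => //; exact: is_derive1_ln.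
have := is_deriveZ 2^-1 dl.
have -> : 2^-1 *: ((p z ^+ 2 + r z ^+ 2)^-1 * (2 * (p z * dp + r z * dr))) =
   (p z * dp + r z * dr) / (p z ^+ 2 + r z ^+ 2).
  by rewrite -[_ *: _]/(_ * _); field; rewrite gt_eqF.
by [].
Qed.

(** After a rotation by - th z the vector (p, r) becomes (X, Y) with X z > 0 and
Y z = 0, and th - th z is the arctangent of Y / X near z.  As Y z = 0 the
derivative is that of Y divided by X z. *)
Lemma is_derive_arg (p r th : V -> R) z v (dp dr : R) :
  is_derive z v p dp -> is_derive z v r dr -> {for z, continuous th} ->
  (\forall x \near z, is_arg (p x, r x) (th x)) ->
  is_derive z v th ((p z * dr - r z * dp) / (p z ^+ 2 + r z ^+ 2)).
Proof.
move=> hp hr cth argth.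
set c := cos (th z); set s := sin (th z).
pose X := c *: p + s *: r; pose Y := (- s) *: p + c *: r.
have cs1 : c ^+ 2 + s ^+ 2 = 1 by exact: cos2Dsin2.
have [m m0 [pz rz]] := nbhs_singleton argth.
have Xz : X z = m.
  have -> : X z = c * p z + s * r z by [].
  by rewrite pz rz -/c -/s -[RHS]mulr1 -cs1; ring.
have Yz : Y z = 0.
  have -> : Y z = - s * p z + c * r z by [].
  by rewrite pz rz -/c -/s; ring.
have dX : is_derive z v X (c * dp + s * dr).
  exact: is_deriveD (is_deriveZ c hp) (is_deriveZ s hr).
have dY : is_derive z v Y (- s * dp + c * dr).
  exact: is_deriveD (is_deriveZ (- s) hp) (is_deriveZ c hr).
have Xn0 : X z != 0 by rewrite Xz gt_eqF.
have dQ : is_derive z v (Y * (fun x => (X x)^-1)) ((- s * dp + c * dr) / m).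
  have dV : is_derive z v (fun x => (X x)^-1) (- (X z) ^- 2 * (c * dp + s * dr)).
    apply: (@is_derive_scalar_comp X z v (fun y => y^-1)) => //.
    have := @is_deriveV R id (X z) 1 1 Xn0 (is_derive_id _ _).
    by rewrite [_ *: _]mulr1.
  by apply: is_derive_eq (is_deriveM dY dV) _; rewrite Yz scale0r add0r Xz [RHS]mulrC.
have dA : is_derive z v (cst (th z) + (@atan R \o (Y * (fun x => (X x)^-1))))
   ((- s * dp + c * dr) / m).
  have := @is_derive_scalar_comp _ z v (@atan R) _ _ (is_derive1_atan _) dQ.
  have -> : (Y * (fun x => (X x)^-1)) z = 0.
    by rewrite -[LHS]/(Y z * _) Yz mul0r.
  rewrite expr0n addr0 invr1 mul1r => dA.
  by have := is_deriveD (is_derive_cst (th z) z v) dA; rewrite add0r.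
have -> : (p z * dr - r z * dp) / (p z ^+ 2 + r z ^+ 2) = (- s * dp + c * dr) / m.
  rewrite pz rz -/c -/s.
  have -> : (m * c) ^+ 2 + (m * s) ^+ 2 = m * m.
    by rewrite -[RHS]mulr1 -cs1; ring.
  by field; rewrite gt_eqF.
apply: near_eq_is_derive dA.
have pi2 : 0 < pi / 2 :> R by rewrite divr_gt0 ?pi_gt0.
have near_th : \forall x \near z, `|th z - th x| < pi / 2.
  by move/cvgrPdist_lt : cth => /(_ _ pi2).
apply: filterS2 argth near_th => x [n n0 [px rx]].
rewrite distrC ltr_norml => tx.
have cd : 0 < cos (th x - th z) by exact: cos_gt0_pihalf.
have EX : X x = n * cos (th x - th z).
  have -> : X x = c * p x + s * r x by [].
  by rewrite px rx cosB -/c -/s; ring.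
have EY : Y x = n * sin (th x - th z).
  have -> : Y x = - s * p x + c * r x by [].
  by rewrite px rx sinB -/c -/s; ring.
have -> : (cst (th z) + (@atan R \o (Y * (fun x => (X x)^-1)))) x =
   th z + atan (Y x / X x) by [].
have -> : Y x / X x = tan (th x - th z).
  by rewrite EX EY /tan; field; rewrite !gt_eqF.
rewrite tanK; first by rewrite addrC subrK.
by rewrite in_itv.
Qed.

End RealDerivatives.

Section ContinuousPartials.
Variables (R : realType).
Implicit Types (D : set (R * R)).

Lemma is_derive_continuous (f : R -> R) (t d : R) :
  is_derive t 1 f d -> {for t, continuous f}.
Proof. by move=> [df _]; apply/differentiable_continuous/derivable1_diffP. Qed.

Lemma mean_value_bound (f g : R -> R) (u w C : R) :
  (forall t, `|u - t| <= `|u - w| -> is_derive t 1 f (g t) /\ `|g t| <= C) ->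
  `|f u - f w| <= C * `|u - w|.
Proof.
have mvt (x y : R) : x < y ->
    (forall t, t \in `[x, y] -> is_derive t 1 f (g t) /\ `|g t| <= C) ->
    `|f y - f x| <= C * `|y - x|.
  move=> xy H; have [||c cxy ->] := @MVT R f g x y xy.
  - by move=> t txy; apply: (H t _).1; exact: subset_itv_oo_cc.
  - apply: continuous_in_subspaceT => t /set_mem txy.
    exact: is_derive_continuous (H t txy).1.
  - by rewrite normrM ler_wpM2r //; apply: (H c _).2; exact: subset_itv_oo_cc.
move=> H; have [wu|uw|->] := ltgtP w u; last by rewrite !subrr normr0 mulr0.
- apply: mvt => // t; rewrite in_itv /= => /andP[wt tu]; apply: H.
  by rewrite !ger0_norm ?subr_ge0 ?(ltW wu) // lerD2l lerN2.
- rewrite distrC [`|u - w|]distrC; apply: mvt => // t.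
  rewrite in_itv /= => /andP[ut tw]; apply: H.
  by rewrite distrC [`|u - w|]distrC !ger0_norm ?subr_ge0 ?(ltW uw) // lerD2r.
Qed.

(** The partial derivatives are named, so that those of composite functions and
the Cauchy-Riemann equations come as explicit formulas. *)
Definition has_partials (W : normedModType R) D (F a b : R * R -> W) :=
  forall z, D z ->
    [/\ is_derive z (1, 0) F (a z), is_derive z (0, 1) F (b z),
        {for z, continuous a} & {for z, continuous b}].

(** A vertical displacement is controlled by the derivative along the second
axis at z alone, a horizontal one by the mean value theorem and a local bound
on the first partial derivative. *)
Lemma partials_continuous D (F a b : R * R -> R) : open D ->
  has_partials D F a b -> forall z, D z -> {for z, continuous F}.
Proof.
move=> oD hF z Dz; have [Fx Fy ca _] := hF z Dz.
have nD : nbhs z D by exact: open_nbhs_nbhs.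
have na : \forall y \near z, `|a y| < `|a z| + 1.
  have /cvgrPdist_lt /(_ _ ltr01) := ca; apply: filterS => y ay.
  rewrite -ltrBlDl; apply: le_lt_trans ay.
  by rewrite distrC; exact: lerB_dist.
have [e /= e0 eB] := (nbhs_ballP _ _).1 (filterI nD na).
have cy : (fun t => F (z.1, t)) @ z.2 --> F z.
  rewrite [z in _ --> F z]surjective_pairing.
  apply: (@is_derive_continuous (fun t => F (z.1, t)) z.2 (b z)).
  move: Fy => /is_derive_lineP Fy; apply/is_derive_lineP; move: Fy.
  congr (is_derive _ _ _ _).
  by apply/funext => h; congr F; congr pair; rewrite /= ?scaler0 ?add0r.
apply/cvgrPdist_lt => eps eps0.
have e2 : 0 < eps / 2 by rewrite divr_gt0.
pose C := `|a z| + 1.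
have C0 : 0 < C by rewrite ltr_pwDr.
have near1 : \forall y \near z, `|F z - F (z.1, y.2)| < eps / 2.
  have /cvgrPdist_lt /(_ _ e2) H := cy.
  exact: (@continuous_snd R R z _ H).
have near2 : \forall y \near z, `|z.1 - y.1| < eps / 2 / C.
  have /cvgrPdist_lt : (fun y : R * R => y.1) @ z --> z.1 by exact: continuous_fst.
  by apply; rewrite divr_gt0.
have near3 : \forall y \near z, ball z e y by apply/nbhs_ballP; exists e.
near=> y.
have Be : ball z e y by near: y.
have slice t : `|z.1 - t| <= `|z.1 - y.1| -> D (t, y.2) /\ `|a (t, y.2)| < C.
  move=> tz; apply: eB; split; last exact: Be.2.
  by apply: le_lt_trans tz _; exact: Be.1.
have der t : `|z.1 - t| <= `|z.1 - y.1| ->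
    is_derive t 1 (fun t => F (t, y.2)) (a (t, y.2)).
  move=> /slice [Dt _]; have [/is_derive_lineP dx _ _ _] := hF _ Dt.
  apply/is_derive_lineP; move: dx; congr (is_derive _ _ _ _).
  by apply/funext => h; congr F; congr pair; rewrite /= ?scaler0 ?add0r.
have mvt : `|F (z.1, y.2) - F y| <= C * `|z.1 - y.1|.
  have -> : F y = F (y.1, y.2) by rewrite -surjective_pairing.
  apply: (@mean_value_bound (fun t => F (t, y.2)) (fun t => a (t, y.2))) => t tz.
  by split; [exact: der|apply: ltW; exact: (slice t tz).2].
rewrite [eps]splitr.
have -> : F z - F y = (F z - F (z.1, y.2)) + (F (z.1, y.2) - F y) by ring.
apply: le_lt_trans (ler_normD _ _) _; apply: ltrD; first by near: y.
apply: le_lt_trans mvt _; rewrite mulrC -ltr_pdivlMr //.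
by near: y.
Unshelve. all: by end_near.
Qed.

End ContinuousPartials.

Section Partials.
Variable R : realType.
Implicit Types (D : set (R * R)).

Lemma has_partials_linear (U W : normedModType R) (L : W -> U) D F a b :
  (forall k x y, L (k *: (x - y)) = k *: (L x - L y)) -> continuous L ->
  has_partials D F a b -> has_partials D (L \o F) (L \o a) (L \o b).
Proof.
move=> linL cL hF z Dz; have [Fx Fy ca cb] := hF z Dz; split.
- exact: is_derive_linear.
- exact: is_derive_linear.
- by apply: continuous_comp => //; exact: cL.
- by apply: continuous_comp => //; exact: cL.
Qed.

Lemma has_partialsD (W : normedModType R) D (F G a b a' b' : R * R -> W) :
  has_partials D F a b -> has_partials D G a' b' ->
  has_partials D (F + G) (a + a') (b + b').
Proof.
move=> hF hG z Dz; have [Fx Fy ca cb] := hF z Dz; have [Gx Gy ca' cb'] := hG z Dz.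
by split; [exact: is_deriveD|exact: is_deriveD|exact: continuousD|exact: continuousD].
Qed.

Lemma has_partialsZ (W : normedModType R) D (k : R) (F a b : R * R -> W) :
  has_partials D F a b -> has_partials D (k *: F) (k *: a) (k *: b).
Proof.
move=> hF z Dz; have [Fx Fy ca cb] := hF z Dz.
by split; [exact: is_deriveZ|exact: is_deriveZ|exact: continuousZl_tmp|exact: continuousZl_tmp].
Qed.

Lemma has_partials_conj D (F a b : R * R -> R) :
  (forall z, D z -> D (cconj z)) -> has_partials D F a b ->
  has_partials D (F \o @cconj R) (a \o @cconj R) (- (b \o @cconj R)).
Proof.
move=> Dc hF z Dz; have [Fx Fy ca cb] := hF _ (Dc z Dz).
have cc : continuous (@cconj R).
  move=> y; apply: cvg_pair_comp; first exact: continuous_fst.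
  by apply: cvgN; exact: continuous_snd.
split.
- move/is_derive_lineP : Fx => Fx; apply/is_derive_lineP; move: Fx.
  congr (is_derive _ _ _ _); apply/funext => t; congr F; congr pair.
  by rewrite /= !scaler0 !add0r.
- move: (is_derive_oppv Fy) => /is_derive_lineP {}Fy; apply/is_derive_lineP; move: Fy.
  congr (is_derive _ _ _ _); apply/funext => t; congr F; congr pair.
    by rewrite /= oppr0.
  by rewrite /= scalerN opprD.
- by apply: continuous_comp; [exact: cc|].
- by apply: continuousN; apply: continuous_comp; [exact: cc|].
Qed.

Lemma has_partials_C1 D (F a b : R * R -> quat R) : open D ->
  has_partials D F a b ->
  C1_on D F /\ (forall z, D z -> dalpha F z = a z /\ dbeta F z = b z).
Proof.
move=> oD hF.
have E z : D z -> dalpha F z = a z /\ dbeta F z = b z.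
  by move=> Dz; have [Fx Fy _ _] := hF z Dz; split; exact: derive_val.
split=> // z Dz; have [Fx Fy ca cb] := hF z Dz.
have nD : nbhs z D by exact: open_nbhs_nbhs.
split; [exact: ex_derive|exact: ex_derive| |].
- rewrite /prop_for /continuous_at (E z Dz).1; apply: cvg_trans ca.
  by apply: near_eq_cvg; apply: filterS nD => y /E[].
- rewrite /prop_for /continuous_at (E z Dz).2; apply: cvg_trans cb.
  by apply: near_eq_cvg; apply: filterS nD => y /E[].
Qed.

Lemma C1_has_partials D (F : R * R -> quat R) :
  C1_on D F -> has_partials D F (dalpha F) (dbeta F).
Proof.
move=> hF z Dz; have [Fx Fy ca cb] := hF z Dz.
split; [exact: (derivableP Fx)|exact: (derivableP Fy)|exact: ca|exact: cb].
Qed.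

Lemma has_partials_slice_pt D (I : quat R) (u v ua ub va vb : R * R -> R) :
  has_partials D u ua ub -> has_partials D v va vb ->
  has_partials D (fun z => slice_pt I (u z, v z)) (fun z => slice_pt I (ua z, va z))
    (fun z => slice_pt I (ub z, vb z)).
Proof.
have lin (q : quat R) (k x y : R) : (k *: (x - y)) *: q = k *: (x *: q - y *: q).
  by rewrite -scalerA scalerBl.
have con (q : quat R) : continuous (fun x : R => x *: q).
  by move=> x; apply: cvgZr_tmp; exact: cvg_id.
move=> hu hv.
exact: (has_partialsD (has_partials_linear (lin 1) (con 1) hu)
  (has_partials_linear (lin I) (con I) hv)).
Qed.

(** These are the real and imaginary parts of dh / h for h = p + i r. *)
Lemma has_partials_logarithm D (p r th pa pb ra rb : R * R -> R) : open D ->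
  has_partials D p pa pb -> has_partials D r ra rb ->
  (forall z, D z -> {for z, continuous th}) ->
  (forall z, D z -> is_arg (p z, r z) (th z)) ->
  let N z := p z ^+ 2 + r z ^+ 2 in
  has_partials D (fun z => 2^-1 * ln (N z))
    (fun z => (p z * pa z + r z * ra z) / N z) (fun z => (p z * pb z + r z * rb z) / N z)
  /\ has_partials D th
    (fun z => (p z * ra z - r z * pa z) / N z) (fun z => (p z * rb z - r z * pb z) / N z).
Proof.
move=> oD hp hr cth argth N.
have cp := partials_continuous oD hp; have cr := partials_continuous oD hr.
have N0 z : D z -> 0 < N z.
  move=> Dz; rewrite /N; have [m m0 [-> ->]] := argth z Dz.
  have -> : (m * cos (th z)) ^+ 2 + (m * sin (th z)) ^+ 2 = m ^+ 2.
    by rewrite -[RHS]mulr1 -(cos2Dsin2 (th z)); ring.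
  by rewrite exprn_gt0.
have cN z : D z -> {for z, continuous (fun z => (N z)^-1)}.
  move=> Dz; apply: cvgV; first by rewrite gt_eqF ?N0.
  by apply: cvgD; apply: cvgM; try exact: cp; exact: cr.
split=> z Dz; have [px py cpa cpb] := hp z Dz; have [rx ry cra crb] := hr z Dz.
- split; [exact: is_derive_log_modulus (N0 z Dz) px rx|
          exact: is_derive_log_modulus (N0 z Dz) py ry| |].
    by apply: cvgM; [apply: cvgD; apply: cvgM => //; [exact: cp|exact: cr]|exact: cN].
  by apply: cvgM; [apply: cvgD; apply: cvgM => //; [exact: cp|exact: cr]|exact: cN].
- have nth : \forall x \near z, is_arg (p x, r x) (th x).
    by apply: filterS (open_nbhs_nbhs (conj oD Dz)) => x; exact: argth.
  split; [exact: is_derive_arg px rx (cth z Dz) nth|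
          exact: is_derive_arg py ry (cth z Dz) nth| |].
    by apply: cvgM; [apply: cvgB; apply: cvgM => //; [exact: cp|exact: cr]|exact: cN].
  by apply: cvgM; [apply: cvgB; apply: cvgM => //; [exact: cp|exact: cr]|exact: cN].
Qed.

End Partials.

Lemma has_partials_eq (R : realType) (W : normedModType R) (D : set (R * R))
    (F a b a' b' : R * R -> W) : open D ->
  (forall z, D z -> a z = a' z /\ b z = b' z) ->
  has_partials D F a b -> has_partials D F a' b'.
Proof.
move=> oD E hF z Dz; have [Fx Fy ca cb] := hF z Dz.
have nD : nbhs z D by exact: open_nbhs_nbhs.
have [ea eb] := E z Dz; split; [by rewrite -ea|by rewrite -eb| |].
- rewrite /prop_for /continuous_at -ea; apply: cvg_trans ca.
  by apply: near_eq_cvg; apply: filterS nD => y /E[].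
- rewrite /prop_for /continuous_at -eb; apply: cvg_trans cb.
  by apply: near_eq_cvg; apply: filterS nD => y /E[].
Qed.

(** Conjugation exchanges the two points z and conj z, and changes the sign of
the second partial derivative. *)
Lemma has_partials_sym (R : realType) (D : set (R * R)) (k : R) (f a b : R * R -> R) :
  (forall z, D z -> D (cconj z)) -> has_partials D f a b ->
  has_partials D (fun z => k * (f z + f (cconj z)))
    (fun z => k * (a z + a (cconj z))) (fun z => k * (b z - b (cconj z))) /\
  has_partials D (fun z => k * (f z - f (cconj z)))
    (fun z => k * (a z - a (cconj z))) (fun z => k * (b z + b (cconj z))).
Proof.
move=> Dc hf; have hc := has_partials_conj Dc hf.
split; first exact: (has_partialsZ k (has_partialsD hf hc)).
have := has_partialsZ k (has_partialsD hf (has_partialsZ (-1) hc)).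
have N (u : R * R -> R) z : (-1 *: u) z = - u z by exact: mulN1r.
have E (u v : R * R -> R) : k *: (u + -1 *: (v \o @cconj R)) =
    (fun z => k * (u z - v (cconj z))).
  by apply/funext => z; rewrite -[LHS]/(k * (u z + (-1 *: (v \o @cconj R)) z)) N.
have E' : k *: (b + -1 *: (- (b \o @cconj R))) = (fun z => k * (b z + b (cconj z))).
  apply/funext => z; rewrite -[LHS]/(k * (b z + (-1 *: (- (b \o @cconj R))) z)) N.
  by congr (_ * (_ + _)); exact: opprK.
by rewrite !E E'.
Qed.

(** * Quaternions and their slices *)

Section Quaternions.
Variable R : realType.
Implicit Types (p q I J : quat R) (z : R * R).

Lemma qnormE q : `|q| = qnorm q. Proof. by []. Qed.

Lemma qnormM p q : `|p * q| = `|p| * `|q|.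
Proof.
rewrite !qnormE /qnorm -sqrtrM ?qsqnorm_ge0 //; congr Num.sqrt.
by case: p q => [a b c d] [a1 b1 c1 d1] /=; ring.
Qed.

Lemma qreD p q : qre (p + q) = qre p + qre q.
Proof. by case: p q => [a b c d] [a1 b1 c1 d1]. Qed.

Lemma qreN q : qre (- q) = - qre q.
Proof. by case: q. Qed.

Lemma qreZ (k : R) q : qre (k *: q) = k * qre q.
Proof. by case: q. Qed.

Lemma qre1 : qre (1 : quat R) = 1. Proof. by []. Qed.

Lemma qre_le q : `|qre q| <= `|q|.
Proof.
rewrite qnormE /qnorm -sqrtr_sqr ler_wsqrtr //.
by case: q => a b c d /=; rewrite -!addrA lerDl !addr_ge0 ?sqr_ge0.
Qed.

Lemma qnorm1 : `|1 : quat R| = 1.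
Proof. by rewrite qnormE /qnorm /= expr1n expr0n !addr0 sqrtr1. Qed.

Lemma imag_unitP I : imag_units I <-> qre I = 0 /\ `|I| = 1.
Proof.
have sq : `|I| ^+ 2 = qsqnorm I by rewrite qnormE sqr_sqrtr // qsqnorm_ge0.
split=> [II|[I0 nI]].
- have nI : `|I| = 1.
    have : `|I| * `|I| = 1 by rewrite -qnormM II normrN qnorm1.
    move/eqP; rewrite -expr2 sqrf_eq1 => /orP[/eqP //|/eqP E].
    by have := normr_ge0 I; rewrite E; lra.
  split => //; move: II sq; rewrite nI /imag_units /=; case: I {nI} => a b c d.
  move=> /(congr1 (@qre R)) /= e0 /= sq.
  by apply/eqP; rewrite -sqrf_eq0; apply/eqP; lra.
- move: I0 sq; rewrite nI /imag_units /=; case: I {nI} => a b c d /= -> sq.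
  by congr Quat; rewrite /=; lra.
Qed.

Lemma lipschitz_continuous (U W : normedModType R) (f : U -> W) (C : R) :
  (forall x y, `|f x - f y| <= C * `|x - y|) -> continuous f.
Proof.
move=> lip x; apply/cvgrPdist_lt => e e0.
have C0 : 0 < `|C| + 1 by rewrite ltr_wpDl.
have : \forall y \near x, `|x - y| < e / (`|C| + 1).
  have /cvgrPdist_lt : (fun y : U => y) @ x --> x by exact: cvg_id.
  by apply; rewrite divr_gt0.
apply: filterS => y xy; apply: le_lt_trans (lip _ _) _.
apply: (@le_lt_trans _ _ ((`|C| + 1) * `|x - y|)).
  by rewrite ler_wpM2r // (le_trans (ler_norm _)) // lerDl.
by rewrite mulrC -ltr_pdivlMr.
Qed.

Lemma continuous_qre : continuous (@qre R).
Proof.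
apply: (@lipschitz_continuous _ _ _ 1) => x y.
by rewrite mul1r -qreN -qreD qre_le.
Qed.

Lemma continuous_qmul p : continuous (fun q => p * q).
Proof.
apply: (@lipschitz_continuous _ _ _ `|p|) => x y.
by rewrite -mulrBr qnormM.
Qed.

(** As I^2 = -1, the real part of - I q is the coordinate along I of a q in the
slice of I. *)
Definition slice_coord I q : R * R := (qre q, - qre (I * q)).

Lemma slice_coordK I : imag_units I -> cancel (slice_pt I) (slice_coord I).
Proof.
move=> hI [a b]; have [I0 _] := (imag_unitP I).1 hI.
rewrite /slice_coord /slice_pt /= mulrDr -!scalerAr hI mulr1.
rewrite !qreD !qreZ qreN qre1 I0; congr pair; ring.
Qed.

Lemma continuous_slice_coord I : continuous (slice_coord I).
Proof.
move=> q; apply: (@cvg_pair_comp _ (nbhs q)); first exact: continuous_qre.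
apply: cvgN; apply: (@cvg_comp _ _ _ (fun q => I * q) (@qre R)).
  exact: continuous_qmul.
exact: continuous_qre.
Qed.

Lemma slice_ptD I z z' : slice_pt I (z.1 + z'.1, z.2 + z'.2) = slice_pt I z + slice_pt I z'.
Proof. by rewrite /slice_pt /= !scalerDl addrACA. Qed.

Lemma continuous_slice_pt I : continuous (slice_pt I).
Proof.
move=> z; apply: cvgD.
  by apply: cvgZr_tmp; exact: continuous_fst.
by apply: cvgZr_tmp; exact: continuous_snd.
Qed.

Lemma slice_pt_comm I z z' : slice_pt I z * slice_pt I z' = slice_pt I z' * slice_pt I z.
Proof.
rewrite /slice_pt !mulrDl !mulrDr -!scalerAl -!scalerAr !mulr1 !mul1r !scalerA.
by rewrite [z'.1 * z.1]mulrC [z'.1 * z.2]mulrC [z'.2 * z.1]mulrC [z'.2 * z.2]mulrC addrACA.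
Qed.

Lemma sliceP I q : imag_units I -> slice I q <-> q = slice_pt I (slice_coord I q).
Proof.
move=> hI; split => [[z _ <-]|->]; first by rewrite slice_coordK.
by exists (slice_coord I q).
Qed.

End Quaternions.

(** * The exponential and star powers on a slice *)

Section Exponential.
Variables (R : realType) (a b : R).

(** The real and imaginary parts of (a + b i)^n. *)
Fixpoint cpow (n : nat) : R * R :=
  if n is m.+1 then
    (a * (cpow m).1 - b * (cpow m).2, a * (cpow m).2 + b * (cpow m).1)
  else (1, 0).

Definition exp_sum (x : nat -> R) (n : nat) (t : R) : R :=
  \sum_(0 <= k < n) (k`!%:R^-1 * x k) * t ^+ k.

Lemma is_derive_exp_term (c : R) n (t : R) :
  is_derive t 1 (fun t : R => ((n.+1)`!%:R^-1 * c) * t ^+ n.+1) ((n`!%:R^-1 * c) * t ^+ n).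
Proof.
have H := is_deriveZ ((n.+1)`!%:R^-1 * c)
  (DeriveDef (@exprn_derivable R n.+1 t 1) (@exp_derive R n.+1 t 1)).
apply: is_derive_eq H _; rewrite -![_ *: _]/(_ * _) mulr1 factS natrM /=.
have f0 : n`!%:R != 0 :> R by rewrite pnatr_eq0 -lt0n fact_gt0.
by field; rewrite f0 nat1r pnatr_eq0.
Qed.

Lemma is_derive_exp_sum (x y : nat -> R) (c d : R) n (t : R) :
  (forall k, x k.+1 = c * x k + d * y k) ->
  is_derive t 1 (exp_sum x n.+1) (c * exp_sum x n t + d * exp_sum y n t).
Proof.
move=> xS; elim: n => [|n IH].
  have -> : exp_sum x 1 = cst (x 0%N).
    by apply/funext => s; rewrite /exp_sum big_nat1 expr0 mulr1 fact0 invr1 mul1r.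
  by apply: is_derive_eq; rewrite /exp_sum !big_geq // !mulr0 addr0.
have -> : exp_sum x n.+2 = exp_sum x n.+1 + (fun t => ((n.+1)`!%:R^-1 * x n.+1) * t ^+ n.+1).
  by apply/funext => s; rewrite /exp_sum big_nat_recr.
apply: is_derive_eq (is_deriveD IH (is_derive_exp_term _ _ _)) _.
by rewrite /exp_sum !big_nat_recr //= xS; ring.
Qed.

(** A mean value inequality with a variable bound; iterating it yields the
factorials of the Taylor remainder, which a constant bound would lose. *)
Lemma derivative_bound (f g df dg : R -> R) : f 0 = 0 -> g 0 = 0 ->
  (forall t : R, t \in `[0, 1] ->
    [/\ is_derive t 1 f (df t), is_derive t 1 g (dg t) & `|df t| <= dg t]) ->
  forall t : R, t \in `[0, 1] -> `|f t| <= g t.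
Proof.
move=> f0 g0 H t; rewrite in_itv /= => /andP[t0 t1].
have sub (s : R) : s \in `[0, t] -> s \in `[0, 1].
  by rewrite !in_itv /= => /andP[-> st]; rewrite (le_trans st).
have key (e : R) : `|e| = 1 -> e * f t <= g t.
  move=> e1; rewrite -subr_ge0.
  pose k (s : R) : R := g s - e * f s.
  pose dk (s : R) : R := dg s - e * df s.
  have D (s : R) : s \in `[0, t] -> is_derive s 1 k (dk s).
    by move=> /sub /H [Df Dg _]; have := is_deriveB Dg (is_deriveZ e Df).
  have ck : {within `[0, t], continuous k}.
    apply: continuous_in_subspaceT => s /set_mem st.
    exact: is_derive_continuous (D s st).
  have Do (s : R) : s \in `]0, t[ -> is_derive s 1 k (dk s).
    by move=> st; apply: D; exact: subset_itv_oo_cc.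
  have [c ct kE] := MVT_segment t0 Do ck.
  have -> : g t - e * f t = k t - k 0 by rewrite /k f0 g0 mulr0 !subr0.
  rewrite kE; apply: mulr_ge0; last by rewrite subr0.
  have [_ _ le] := H c (sub c ct); rewrite subr_ge0.
  by apply: le_trans le; rewrite (le_trans (ler_norm _)) // normrM e1 mul1r.
rewrite ler_norml; apply/andP; split.
  by have := key (-1); rewrite normrN normr1 => /(_ erefl); lra.
by have := key 1; rewrite normr1 => /(_ erefl); lra.
Qed.

Let ex (t : R) := expR (a * t) * cos (b * t).
Let ey (t : R) := expR (a * t) * sin (b * t).

Lemma is_derive_comp_scale (f : R -> R) (c t d : R) :
  is_derive (c * t) 1 f d -> is_derive t 1 (fun t : R => f (c * t)) (c * d).
Proof.
move=> df; have H := @is_deriveZ _ _ _ (@id R) c t 1 1 (is_derive_id _ _).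
have := @is_derive1_comp _ f (c *: (@id R)) t d (c *: 1) df H.
by rewrite [c *: 1]mulr1 mulrC.
Qed.

(** The derivative of the (n+1)-st remainder of t |-> exp ((a + b i) t) is
a + b i times the n-th one, so the bound is integrated from n to n + 1. *)
Lemma exp_remainder n (t : R) : t \in `[0, 1] ->
  `|ex t - exp_sum (fun k => (cpow k).1) n t| <=
     n`!%:R^-1 * (expR `|a| * (`|a| + `|b|) ^+ n) * t ^+ n /\
  `|ey t - exp_sum (fun k => (cpow k).2) n t| <=
     n`!%:R^-1 * (expR `|a| * (`|a| + `|b|) ^+ n) * t ^+ n.
Proof.
set x := fun k => (cpow k).1; set y := fun k => (cpow k).2.
set C := `|a| + `|b|; set M := expR `|a|.
elim: n t => [|n IH] t t01.
  rewrite /exp_sum !big_geq // !subr0 expr0 expr0 fact0 invr1 mul1r !mulr1.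
  move: t01; rewrite in_itv /= => /andP[t0 t1].
  have le : `|expR (a * t)| <= M.
    rewrite ger0_norm ?expR_ge0 // ler_expR (le_trans (ler_norm _)) // normrM.
    by rewrite ler_piMr // ger0_norm.
  by split; rewrite normrM (le_trans _ le) // ler_piMr // ?cos_max ?sin_max.
have dex (s : R) : is_derive s 1 ex (a * ex s - b * ey s).
  have h1 := is_derive_comp_scale (is_derive_expR (a * s)).
  have h2 := is_derive_comp_scale (is_derive_cos (b * s)).
  apply: is_derive_eq (is_deriveM h1 h2) _.
  by rewrite /ex /ey -![_ *: _]/(_ * _); ring.
have dey (s : R) : is_derive s 1 ey (a * ey s + b * ex s).
  have h1 := is_derive_comp_scale (is_derive_expR (a * s)).
  have h2 := is_derive_comp_scale (is_derive_sin (b * s)).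
  apply: is_derive_eq (is_deriveM h1 h2) _.
  by rewrite /ex /ey -![_ *: _]/(_ * _); ring.
have xS k : x k.+1 = a * x k + (- b) * y k by rewrite /x /= mulNr.
have yS k : y k.+1 = a * y k + b * x k by [].
have dsx s := is_derive_exp_sum n s xS; have dsy s := is_derive_exp_sum n s yS.
have bnd (s X Y c d : R) : s \in `[0, 1] -> `|c| + `|d| <= C ->
    `|X| <= n`!%:R^-1 * (M * C ^+ n) * s ^+ n ->
    `|Y| <= n`!%:R^-1 * (M * C ^+ n) * s ^+ n ->
    `|c * X + d * Y| <= n`!%:R^-1 * (M * C ^+ n.+1) * s ^+ n.
  move=> s01 cd bX bY; apply: le_trans (ler_normD _ _) _; rewrite !normrM.
  have -> : n`!%:R^-1 * (M * C ^+ n.+1) * s ^+ n =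
     C * (n`!%:R^-1 * (M * C ^+ n) * s ^+ n) by rewrite exprS; ring.
  set B := _ * s ^+ n in bX bY *.
  apply: (@le_trans _ _ ((`|c| + `|d|) * B)).
    by rewrite mulrDl lerD // ler_wpM2l.
  by rewrite ler_wpM2r // (le_trans _ bX).
have z0 : forall u : nat -> R, exp_sum u n.+1 0 = u 0%N.
  move=> u; rewrite /exp_sum big_nat_recl // big1 ?addr0 ?expr0 ?mulr1 ?fact0 ?invr1 ?mul1r //.
  by move=> i _; rewrite expr0n mulr0.
split.
- apply: (@derivative_bound (fun t => ex t - exp_sum x n.+1 t)
    (fun t => (n.+1)`!%:R^-1 * (M * C ^+ n.+1) * t ^+ n.+1)
    (fun s => a * (ex s - exp_sum x n s) + (- b) * (ey s - exp_sum y n s))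
    (fun s => n`!%:R^-1 * (M * C ^+ n.+1) * s ^+ n) _ _ _ t t01).
  + rewrite z0 /ex !mulr0 expR0 cos0 mulr1.
    by rewrite subrr.
  + by rewrite expr0n mulr0.
  + move=> s s01; split; last first.
      by apply: bnd => //; [rewrite normrN|exact: (IH s s01).1|exact: (IH s s01).2].
    exact: is_derive_exp_term.
    by apply: is_derive_eq (is_deriveB (dex s) (dsx s)) _; ring.
- apply: (@derivative_bound (fun t => ey t - exp_sum y n.+1 t)
    (fun t => (n.+1)`!%:R^-1 * (M * C ^+ n.+1) * t ^+ n.+1)
    (fun s => a * (ey s - exp_sum y n s) + b * (ex s - exp_sum x n s))
    (fun s => n`!%:R^-1 * (M * C ^+ n.+1) * s ^+ n) _ _ _ t t01).
  + rewrite z0 /ey !mulr0 expR0 sin0 mulr0.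
    by rewrite subrr.
  + by rewrite expr0n mulr0.
  + move=> s s01; split; last first.
      by apply: bnd => //; [exact: (IH s s01).2|exact: (IH s s01).1].
    exact: is_derive_exp_term.
    by apply: is_derive_eq (is_deriveB (dey s) (dsy s)) _; ring.
Qed.

Lemma cvg_exp_sum :
  (exp_sum (fun k => (cpow k).1))^~ 1 @ \oo --> expR a * cos b /\
  (exp_sum (fun k => (cpow k).2))^~ 1 @ \oo --> expR a * sin b.
Proof.
set C := `|a| + `|b|; set M := expR `|a|.
have b0 : (fun n => M * exp_coeff C n) @ \oo --> (0 : R).
  have h : exp_coeff C @ \oo --> (0 : R).
    by apply: cvg_series_cvg_0; exact: is_cvg_series_exp_coeff.
  by rewrite -[X in _ --> X](mulr0 M); apply: cvgMl_tmp.
have key (S : nat -> R) (l : R) : (forall n, `|l - S n| <= M * exp_coeff C n) -> S @ \oo --> l.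
  move=> bS; apply/cvgrPdist_le => e e0.
  have /cvgrPdist_le /(_ e e0) := b0; apply: filterS => n.
  by rewrite sub0r normrN => /(le_trans (ler_norm _)); exact: le_trans.
have E n : n`!%:R^-1 * (M * C ^+ n) * 1 ^+ n = M * exp_coeff C n.
  by rewrite expr1n mulr1 /exp_coeff /=; ring.
by split; apply: key => n; have [] := exp_remainder n (in01_1 R);
  rewrite /ex /ey !mulr1 E.
Qed.

Lemma cvg_slice_exp (I : quat R) : imag_units I ->
  series (fun n => (n`!%:R : R)^-1 *: slice_pt I (a, b) ^+ n) @ \oo -->
  slice_pt I (expR a * cos b, expR a * sin b).
Proof.
move=> II; have [c1 c2] := cvg_exp_sum.
have pw n : slice_pt I (a, b) ^+ n = slice_pt I (cpow n).
  elim: n => [|n IH]; first by rewrite expr0 /slice_pt /= scale1r scale0r addr0.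
  rewrite exprS IH /=; case: (cpow n) => x y; rewrite /slice_pt /=.
  rewrite mulrDl !mulrDr -!scalerAl -!scalerAr !mulr1 !mul1r II !scalerA.
  rewrite scalerBl scalerDl scalerN [RHS]addrACA.
  by rewrite [- _ + _ in RHS]addrC.
have -> : series (fun n => (n`!%:R : R)^-1 *: slice_pt I (a, b) ^+ n) =
    fun n => slice_pt I (exp_sum (fun k => (cpow k).1) n 1, exp_sum (fun k => (cpow k).2) n 1).
  apply/funext => n; rewrite /series /exp_sum /slice_pt /= !scaler_suml -big_split /=.
  apply: eq_bigr => k _; rewrite pw /slice_pt scalerDr !scalerA expr1n !mulr1.
  by [].
apply: (@cvg_comp _ _ _ _ (slice_pt I) \oo _ _ (cvg_pair_comp c1 c2)).
exact: continuous_slice_pt.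
Qed.

End Exponential.

Section StarPowers.
Variable R : realType.
Implicit Types (I J K u v : quat R) (f : quat R -> quat R).

(** The representation formula: the value at alpha + J beta of the slice function
with values u at alpha + I beta and v at alpha - I beta. *)
Definition representation I J u v : quat R :=
  2^-1 *: ((1 - J * I) * u + (1 + J * I) * v).

Lemma half_double (q : quat R) : 2^-1 *: (q + q) = q.
Proof.
rewrite -[q in q + q]scale1r -scalerDl scalerA.
have -> : 2^-1 * (1 + 1) = 1 :> R by field.
exact: scale1r.
Qed.

Lemma imag_unit_conjg (c J : quat R) : c != 0 -> imag_units J ->
  imag_units (c^-1 * J * c).
Proof.
move=> c0 JJ; have cu : c \is a GRing.unit by [].
rewrite /imag_units /= mulrA [c^-1 * J * c * (c^-1 * J)]mulrA -(mulrA (c^-1 * J) c).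
by rewrite divrr // mulr1 -(mulrA c^-1 J J) JJ mulrN1 mulNr mulVr.
Qed.

Lemma conjg_slice_pt (c J : quat R) z : c != 0 ->
  c^-1 * slice_pt J z * c = slice_pt (c^-1 * J * c) z.
Proof.
move=> c0; have : c^-1 * c = 1 by exact: mulVr.
move: (c^-1) => d dc.
by rewrite /slice_pt mulrDr mulrDl -!scalerAr -!scalerAl mulr1 dc.
Qed.

(** A star product at alpha + J beta is c times a value at alpha + K beta with
c K = J c.  This relation, and u and v commuting with I, give
c (1 - K I) = (1 - J I) u and c (1 + K I) = (1 + J I) v: the values at the two
conjugate points are multiplied independently. *)
Lemma representation_mul I J K u v x y (c : quat R) :
  imag_units I -> imag_units J -> u * I = I * u -> v * I = I * v ->
  c = representation I J u v -> c * K = J * c ->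
  c * representation I K x y = representation I J (u * x) (v * y).
Proof.
move=> II JJ uI vI cE cK.
have JcI : J * c * I = 2^-1 *: ((J * I - 1) * u + (J * I + 1) * v).
  rewrite cE /representation -scalerAr -scalerAl; congr (_ *: _).
  rewrite mulrDr mulrDl -!mulrA uI vI !mulrA; congr (_ * _ + _ * _).
    by rewrite mulrBr mulr1 mulrA JJ mulN1r opprK mulrDl II.
  by rewrite mulrDr mulr1 mulrA JJ mulN1r mulrDl mulNr II opprK.
have E1 : c * (1 - K * I) = (1 - J * I) * u.
  rewrite mulrBr mulr1 mulrA cK JcI {1}cE /representation -scalerBr.
  have -> : (1 - J * I) * u + (1 + J * I) * v - ((J * I - 1) * u + (J * I + 1) * v) =
     (1 - J * I) * u + (1 - J * I) * u.
    rewrite [J * I + 1]addrC opprD addrACA subrr addr0.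
    by rewrite -[- (_ * u)]mulNr opprB.
  exact: half_double.
have E2 : c * (1 + K * I) = (1 + J * I) * v.
  rewrite mulrDr mulr1 mulrA cK JcI {1}cE /representation -scalerDr.
  have -> : (1 - J * I) * u + (1 + J * I) * v + ((J * I - 1) * u + (J * I + 1) * v) =
     (1 + J * I) * v + (1 + J * I) * v.
    by rewrite [J * I + 1]addrC addrACA -[J * I - 1]opprB mulNr subrr add0r.
  exact: half_double.
by rewrite /representation -scalerAr mulrDr !mulrA E1 E2.
Qed.

(** The variable is conjugated by the value c of f, which sends J to
K = c^-1 J c; that is the situation of [representation_mul].  When c = 0 the
star product is 0 by definition, and so is the formula. *)
Lemma star_pow_slice f I z u v : imag_units I -> u * I = I * u -> v * I = I * v ->
  (forall J, imag_units J -> f (slice_pt J z) = representation I J u v) ->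
  forall n J, imag_units J ->
    star_pow f n (slice_pt J z) = representation I J (u ^+ n) (v ^+ n).
Proof.
move=> II uI vI fz; elim=> [|n IH] J JJ.
  rewrite /= /representation !expr0 !mulr1 addrACA addNr addr0.
  by rewrite half_double.
rewrite /= /star_mul !exprS.
case: eqVneq => [f0|f0].
  rewrite -(@representation_mul I J J u v (u ^+ n) (v ^+ n) _ II JJ uI vI (fz J JJ)) f0.
    by rewrite mul0r.
  by rewrite mul0r mulr0.
rewrite conjg_slice_pt // IH; last exact: imag_unit_conjg.
apply: representation_mul (fz J JJ) _ => //.
have : f (slice_pt J z) * (f (slice_pt J z))^-1 = 1 by exact: mulrV.
by move: (f (slice_pt J z)) (f (slice_pt J z))^-1 => c d cd; rewrite !mulrA cd mul1r.
Qed.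

Lemma cvg_representation I J (u v : nat -> quat R) (lu lv : quat R) :
  u @ \oo --> lu -> v @ \oo --> lv ->
  (fun n => representation I J (u n) (v n)) @ \oo --> representation I J lu lv.
Proof.
move=> hu hv; apply: cvgZl_tmp; apply: cvgD.
  apply: (@cvg_comp _ _ _ u (fun q => (1 - J * I) * q) _ _ _ hu).
  exact: continuous_qmul.
apply: (@cvg_comp _ _ _ v (fun q => (1 + J * I) * q) _ _ _ hv).
exact: continuous_qmul.
Qed.

Lemma star_exp_slice f I z (l l' : R * R) : imag_units I ->
  (forall J, imag_units J ->
    f (slice_pt J z) = representation I J (slice_pt I l) (slice_pt I l')) ->
  forall J, imag_units J ->
    series (fun n => (n`!%:R : R)^-1 *: star_pow f n (slice_pt J z)) @ \oo -->
    representation I J (slice_pt I (expR l.1 * cos l.2, expR l.1 * sin l.2))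
      (slice_pt I (expR l'.1 * cos l'.2, expR l'.1 * sin l'.2)).
Proof.
move=> II fz J JJ.
have comm (w : R * R) : slice_pt I w * I = I * slice_pt I w.
  by rewrite /slice_pt mulrDl mulrDr -!scalerAl -!scalerAr mul1r mulr1.
have -> : series (fun n => (n`!%:R : R)^-1 *: star_pow f n (slice_pt J z)) =
   fun n => representation I J (series (fun n => (n`!%:R : R)^-1 *: slice_pt I l ^+ n) n)
     (series (fun n => (n`!%:R : R)^-1 *: slice_pt I l' ^+ n) n).
  apply/funext => n; rewrite /series /representation /= !mulr_sumr -big_split /= scaler_sumr.
  apply: eq_bigr => k _; rewrite (@star_pow_slice _ I _ (slice_pt I l) (slice_pt I l')) //.
  by rewrite /representation -!scalerAr -scalerDr !scalerA mulrC.
case: l {fz} => l1 l2; case: l' => l1' l2'.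
by apply: cvg_representation; exact: cvg_slice_exp.
Qed.

End StarPowers.

(** * Slice functions on circular sets *)

Section SliceAlgebra.
Variable R : realType.
Implicit Types (q I J u v : quat R) (z w : R * R).

Lemma imag_unitN J : imag_units J -> imag_units (- J).
Proof. by rewrite /imag_units /= mulrNN. Qed.

Definition quat_i : quat R := Quat 0 1 0 0.
Definition quat_j : quat R := Quat 0 0 1 0.

Lemma imag_unit_i : imag_units quat_i.
Proof. by congr Quat; rewrite /=; ring. Qed.

Lemma imag_unit_j : imag_units quat_j.
Proof. by congr Quat; rewrite /=; ring. Qed.

Lemma slice_pt_oppl J z : slice_pt (- J) z = slice_pt J (cconj z).
Proof. by rewrite /slice_pt /= scalerN scaleNr. Qed.

Lemma cconjK : involutive (@cconj R).
Proof. by case=> a b; rewrite /cconj /= opprK. Qed.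

Lemma slice_pt_real J (x : R) : slice_pt J (x, 0) = x%:A.
Proof. by rewrite /slice_pt /= scale0r addr0. Qed.

Lemma imag_mul_slice_pt J z : imag_units J -> J * slice_pt J z = slice_pt J (- z.2, z.1).
Proof.
by move=> JJ; rewrite /slice_pt mulrDr -!scalerAr JJ mulr1 /= scalerN scaleNr addrC.
Qed.

Lemma slice_pt_inj J : imag_units J -> injective (slice_pt J).
Proof. by move=> JJ; exact: can_inj (slice_coordK JJ). Qed.

Lemma qre_slice_pt J z : imag_units J -> qre (slice_pt J z) = z.1.
Proof. by move=> JJ; have := slice_coordK JJ z; case: z => a b []. Qed.

Lemma qim_slice_pt J z : imag_units J -> qim (slice_pt J z) = z.2 *: J.
Proof. by move=> JJ; rewrite /qim qre_slice_pt // /slice_pt addrC addKr. Qed.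

Lemma norm_qim_slice_pt J z : imag_units J -> `|qim (slice_pt J z)| = `|z.2|.
Proof.
by move=> JJ; rewrite qim_slice_pt // normrZ ((imag_unitP J).1 JJ).2 mulr1.
Qed.

Lemma slice_decomposition q : exists J z, imag_units J /\ q = slice_pt J z.
Proof.
have qE : q = (qre q)%:A + qim q by rewrite /qim addrC subrK.
have [q0|q0] := eqVneq (qim q) 0.
  exists quat_i, (qre q, 0); split; first exact: imag_unit_i.
  by rewrite slice_pt_real {1}qE q0 addr0.
have n0 : `|qim q| != 0 by rewrite normr_eq0.
exists (`|qim q|^-1 *: qim q), (qre q, `|qim q|); split; last first.
  by rewrite /slice_pt /= scalerA mulfV // scale1r.
apply/imag_unitP; split.
  by rewrite qreZ /qim qreD qreN qreZ qre1 mulr1 subrr mulr0.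
by rewrite normrZ normfV normr_id mulVf.
Qed.

Lemma commute_units_real q : (forall J, imag_units J -> J * q = q * J) ->
  q = (qre q)%:A.
Proof.
move=> comm; have := comm _ imag_unit_i; have := comm _ imag_unit_j.
case: q {comm} => a b c d [] e1 e2 e3 e4 [] e5 e6 e7 e8.
by congr Quat; rewrite /=; lra.
Qed.

Lemma representation_diag I u v : imag_units I -> representation I I u v = u.
Proof.
move=> II; rewrite /representation II opprK subrr mul0r addr0 mulrDl mul1r.
exact: half_double.
Qed.

Lemma representation_stem I J u v : imag_units I ->
  representation I J (u + I * v) (u - I * v) = u + J * v.
Proof.
move=> II; rewrite /representation.
have -> : (1 - J * I) * (u + I * v) + (1 + J * I) * (u - I * v) =
   (u + J * v) + (u + J * v); last exact: half_double.
have E (s t x y : quat R) : s + t - (x - y) + (s - t + (x + y)) = (s + y) + (s + y).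
  rewrite opprB addrACA [s + t + _]addrACA subrr addr0 [y - x + _]addrA subrK.
  exact: addrACA.
rewrite mulrBl mulrDl !mul1r -!(mulrA J) [I * (u + _)]mulrDr [I * (u - _)]mulrBr.
by rewrite !(mulrA I) II mulN1r opprK mulrBr mulrDr E.
Qed.

End SliceAlgebra.

Section CircularSets.
Variables (R : realType) (Omega : set (quat R)).
Hypothesis circ : circular Omega.
Hypothesis oOmega : open Omega.
Let D := stem_domain Omega.
Implicit Types (z : R * R) (I J : quat R).

(** The sphere through alpha + I beta contains alpha + |beta| J for every
imaginary unit J, hence also alpha + beta J, on replacing J by - J. *)
Lemma stem_domainP z : D z -> forall J, imag_units J -> Omega (slice_pt J z).
Proof.
move=> [I II Oz] J JJ.
have sph K : imag_units K -> Omega (z.1%:A + `|z.2| *: K).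
  move=> KK; apply: (circ Oz); exists K => //.
  by rewrite qre_slice_pt // norm_qim_slice_pt.
rewrite /slice_pt; have [z0|z0] := lerP 0 z.2.
  by have := sph J JJ; rewrite ger0_norm.
by have := sph _ (imag_unitN JJ); rewrite ltr0_norm // scalerN scaleNr opprK.
Qed.

Lemma stem_domain_conj z : D z -> D (cconj z).
Proof.
move=> [I II Oz]; exists (- I); first exact: imag_unitN.
by rewrite slice_pt_oppl cconjK.
Qed.

Lemma stem_domain_preimage I : imag_units I -> D = slice_pt I @^-1` Omega.
Proof.
move=> II; apply/seteqP; split=> [z Dz|z Oz]; first exact: stem_domainP.
by exists I.
Qed.

Lemma open_stem_domain : open D.
Proof.
rewrite (stem_domain_preimage (imag_unit_i R)).
apply: open_comp oOmega => z _; exact: continuous_slice_pt.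
Qed.

(** slice_pt I is a homeomorphism from the plane onto the slice of I, with
inverse slice_coord I. *)
Lemma simply_connected_preimage I (A C : set (quat R)) : imag_units I ->
  A `<=` slice I -> simply_connected_domain_of R C A ->
  [/\ slice_pt I @^-1` A !=set0, connected (slice_pt I @^-1` A)
    & @null_homotopic_loops R (R * R)%type (slice_pt I @^-1` A)].
Proof.
move=> II AI [[[q Aq] cA _] nullA].
have K := slice_coordK II.
have AK q' : A q' -> slice_pt I (slice_coord I q') = q'.
  by move=> /AI /(sliceP _ II).
split.
- by exists (slice_coord I q); rewrite /= AK.
- have -> : slice_pt I @^-1` A = slice_coord I @` A.
    apply/seteqP; split=> [z Az|_ [q' Aq' <-]]; last by rewrite /= AK.
    by exists (slice_pt I z) => //; exact: K.
  apply: connected_continuous_connected => //.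
  by apply: continuous_subspaceT => x; exact: continuous_slice_coord.
- move=> g cg Ag g01.
  have cg' : {within `[0, 1], continuous (slice_pt I \o g)}.
    by move=> t; apply: (@continuous_comp _ _ _ _ (slice_pt I) _ (cg t)); exact: continuous_slice_pt.
  have [|H [cH AH H0 H1 Hs]] := nullA (slice_pt I \o g) cg' (fun t t01 => Ag t t01).
    by rewrite /= g01.
  exists (slice_coord I \o H); split.
  + by move=> t; apply: (@continuous_comp _ _ _ _ (slice_coord I) _ (cH t)); exact: continuous_slice_coord.
  + by move=> s t s01 t01; rewrite /= AK; exact: AH.
  + by move=> t t01; rewrite /= H0 //= K.
  + by move=> t t01; rewrite /= H1 //= K.
  + by move=> s s01; have [e0 e1] := Hs s s01; rewrite /= e0 e1 /= K.
Qed.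

(** At a nonreal point the imaginary unit is read off the imaginary part, up to
a sign that the parity of F0 and F1 absorbs.  At a real point it is
undetermined, but there F1 vanishes, being odd. *)
Lemma slice_function (F0 F1 : R * R -> quat R) :
  (forall z, D z -> F0 (cconj z) = F0 z /\ F1 (cconj z) = - F1 z) ->
  exists f : quat R -> quat R, forall J z, imag_units J -> D z ->
    f (slice_pt J z) = F0 z + J * F1 z.
Proof.
move=> sym; pose zeta (q : quat R) := (qre q, `|qim q|).
exists (fun q => F0 (zeta q) + (`|qim q|^-1 *: qim q) * F1 (zeta q)) => J z JJ Dz.
have [e0 e1] := sym z Dz.
rewrite /zeta norm_qim_slice_pt // qre_slice_pt // qim_slice_pt // scalerA.
have [z0|z0|z0] := ltgtP 0 z.2.
- by rewrite gtr0_norm // mulVf ?gt_eqF // scale1r -surjective_pairing.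
- rewrite ltr0_norm // -[(_, _)]/(cconj z) e0 e1 invrN mulNr mulVf ?lt_eqF //.
  by rewrite scaleN1r mulrNN.
- have zz : cconj z = z by rewrite [RHS]surjective_pairing /cconj -z0 oppr0.
  have F10 : F1 z = 0.
    by rewrite -[LHS]half_double -{2}zz e1 subrr scaler0.
  by rewrite -z0 normr0 z0 -surjective_pairing F10 !mulr0.
Qed.

End CircularSets.

Section Logarithm.
Variables (R : realType) (Omega : set (quat R)).
Hypothesis circ : circular Omega.
Hypothesis oOmega : open Omega.
Let D := stem_domain Omega.
Implicit Types (z : R * R) (I J : quat R).

Lemma exp_log_polar (w : R * R) (t : R) : is_arg w t ->
  (expR (2^-1 * ln (w.1 ^+ 2 + w.2 ^+ 2)) * cos t,
   expR (2^-1 * ln (w.1 ^+ 2 + w.2 ^+ 2)) * sin t) = w.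
Proof.
move=> [m m0 ->] /=.
have -> : (m * cos t) ^+ 2 + (m * sin t) ^+ 2 = m ^+ 2.
  by rewrite -[RHS]mulr1 -(cos2Dsin2 t); ring.
rewrite lnXn //; have -> : 2^-1 * (ln m *+ 2) = ln m by field.
by rewrite lnK.
Qed.

Variables (g : quat R -> quat R) (G0 G1 : R * R -> quat R) (I : quat R).
Hypothesis II : imag_units I.
Hypothesis G0_C1 : C1_on D G0.
Hypothesis G1_C1 : C1_on D G1.
Hypothesis G_sym : forall z, D z -> G0 (cconj z) = G0 z /\ G1 (cconj z) = - G1 z.
Hypothesis G_CR : forall z, D z ->
  dalpha G0 z = dbeta G1 z /\ dbeta G0 z = - dalpha G1 z.
Hypothesis gE : forall J z, imag_units J -> Omega (slice_pt J z) ->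
  g (slice_pt J z) = G0 z + J * G1 z.
Hypothesis g_slice : preserves_slice Omega g I.
Hypothesis g_neq0 : forall q, Omega q -> g q != 0.

(** The trace of g on the slice of I, in the coordinates of that slice. *)
Definition slice_value z : R * R := slice_coord I (G0 z + I * G1 z).
Local Notation w := slice_value.

Lemma slice_valueK z : D z -> slice_pt I (w z) = G0 z + I * G1 z.
Proof.
move=> Dz; have Oz := stem_domainP circ Dz II; rewrite -gE //.
by rewrite /w -gE //; apply/esym/(sliceP _ II); apply: g_slice; exists (slice_pt I z) => //; split => //; exists z.
Qed.

Lemma slice_value_neq0 z : D z -> w z != (0, 0).
Proof.
move=> Dz; have Oz := stem_domainP circ Dz II; have := g_neq0 Oz.
apply: contraNneq => w0; rewrite gE // -slice_valueK // w0 slice_pt_real.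
by rewrite scale0r.
Qed.

Let da z := dalpha G0 z + I * dalpha G1 z.

(** The Cauchy-Riemann equations of the stem say that h = G0 + I G1 satisfies
d h / d beta = I (d h / d alpha), so both partial derivatives of h come from
the derivative da along the first axis. *)
Lemma slice_value_partials :
  has_partials D (fun z => (w z).1) (fun z => qre (da z)) (fun z => qre (I * da z)) /\
  has_partials D (fun z => (w z).2) (fun z => - qre (I * da z)) (fun z => qre (da z)).
Proof.
have linm (q : quat R) (k : R) x y : q * (k *: (x - y)) = k *: (q * x - q * y).
  by rewrite -scalerAr mulrBr.
have linre (k : R) (x y : quat R) : qre (k *: (x - y)) = k *: (qre x - qre y).
  by rewrite qreZ qreD qreN.
have hG := has_partialsD (C1_has_partials G0_C1)
  (has_partials_linear (linm I) (@continuous_qmul _ I) (C1_has_partials G1_C1)).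
have cm (q : quat R) : continuous (fun x => qre (q * x)).
  move=> x; apply: (@continuous_comp _ _ _ (fun x => q * x) (@qre R)).
    exact: continuous_qmul.
  exact: continuous_qre.
have lm (q : quat R) (k : R) (x y : quat R) :
   qre (q * (k *: (x - y))) = k *: (qre (q * x) - qre (q * y)).
  by rewrite linm linre.
have E z : D z -> dbeta G0 z + I * dbeta G1 z = I * da z.
  move=> Dz; have [e1 e2] := G_CR Dz.
  by rewrite /da mulrDr mulrA II mulN1r e2 e1 addrC.
have oD : open D by exact: open_stem_domain.
split.
- apply: has_partials_eq oD _ (has_partials_linear linre (@continuous_qre R) hG) => z Dz.
  by split => //=; rewrite -E.
- have h := has_partialsZ (-1) (has_partials_linear (lm I) (cm I) hG).
  have -> : (fun z => (w z).2) = -1 *: ((fun q => qre (I * q)) \o (G0 + ((fun q => I * q) \o G1))).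
    by apply/funext => z; rewrite -[RHS]/(-1 * qre (I * (G0 z + I * G1 z))) mulN1r.
  apply: has_partials_eq oD _ h => z Dz; split; first by rewrite -[LHS]/(-1 * qre (I * da z)) mulN1r.
  rewrite -[LHS]/(-1 * qre (I * (dbeta G0 z + I * dbeta G1 z))) E // mulN1r.
  by rewrite mulrA II mulN1r qreN opprK.
Qed.

Variable th : R * R -> R.
Hypothesis th_cont : forall z, D z -> {for z, continuous th}.
Hypothesis th_arg : forall z, D z -> is_arg (w z) (th z).

Definition log_modulus z : R := 2^-1 * ln ((w z).1 ^+ 2 + (w z).2 ^+ 2).
Local Notation la := log_modulus.

(** With l = la + I th, [log_stem0] and [log_stem1] are the coordinates along 1
and I of (l z + l (conj z)) / 2 and of - I (l z - l (conj z)) / 2. *)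
Definition log_stem0 z : R * R :=
  (2^-1 * (la z + la (cconj z)), 2^-1 * (th z + th (cconj z))).
Definition log_stem1 z : R * R :=
  (2^-1 * (th z - th (cconj z)), - 2^-1 * (la z - la (cconj z))).

Lemma log_representation J z : imag_units J ->
  slice_pt I (log_stem0 z) + J * slice_pt I (log_stem1 z) =
  representation I J (slice_pt I (la z, th z)) (slice_pt I (la (cconj z), th (cconj z))).
Proof.
move=> JJ.
have e1 : slice_pt I (la z, th z) =
    slice_pt I (log_stem0 z) + I * slice_pt I (log_stem1 z).
  by rewrite imag_mul_slice_pt // -slice_ptD /=; congr slice_pt; congr pair; field.
have e2 : slice_pt I (la (cconj z), th (cconj z)) =
    slice_pt I (log_stem0 z) - I * slice_pt I (log_stem1 z).
  rewrite -mulNr -[- I]mulrN1 -mulrA mulN1r -[- slice_pt I (log_stem1 z)]/(- _).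
  have -> : - slice_pt I (log_stem1 z) = slice_pt I (- (log_stem1 z).1, - (log_stem1 z).2).
    by rewrite /slice_pt /= !scaleNr -opprD.
  by rewrite imag_mul_slice_pt // -slice_ptD /=; congr slice_pt; congr pair; field.
by rewrite e1 e2 representation_stem.
Qed.

Lemma logarithm_exists : exists f : quat R -> quat R,
  [/\ star_log Omega g f, preserves_slice Omega f I &
    forall J z, imag_units J -> D z ->
      f (slice_pt J z) = slice_pt I (log_stem0 z) + J * slice_pt I (log_stem1 z)].
Proof.
have oD : open D by exact: open_stem_domain.
pose F0 z := slice_pt I (log_stem0 z); pose F1 z := slice_pt I (log_stem1 z).
have F_sym z : D z -> F0 (cconj z) = F0 z /\ F1 (cconj z) = - F1 z.
  move=> _; rewrite /F0 /F1 /log_stem0 /log_stem1 cconjK /slice_pt /= opprD -[- (_%:A)]scaleNr -[- (_ *: I)]scaleNr.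
  by split; congr (_ *: _ + _ *: _); ring.
have [f fE] := slice_function F_sym; exists f; split => //.
- split; last first.
    move=> q; have [J [z [JJ ->]]] := slice_decomposition q => Oz.
    have Dz : D z by exists J.
    have fz K : imag_units K -> f (slice_pt K z) =
        representation I K (slice_pt I (la z, th z)) (slice_pt I (la (cconj z), th (cconj z))).
      by move=> KK; rewrite fE // log_representation.
    have := star_exp_slice II fz JJ => /=.
    have Dzc := stem_domain_conj Dz.
    rewrite (exp_log_polar (th_arg Dz)) (exp_log_polar (th_arg Dzc)) !slice_valueK //.
    have [-> ->] := G_sym Dz.
    by rewrite mulrN representation_stem // -gE.
  have [hp hr] := slice_value_partials.
  have [hla hth] := has_partials_logarithm oD hp hr th_cont th_arg.
  set p := fun z => (w z).1 in hla hth; set r := fun z => (w z).2 in hla hth.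
  pose N z := p z ^+ 2 + r z ^+ 2.
  pose La z := (p z * qre (da z) - r z * qre (I * da z)) / N z.
  pose Lb z := (p z * qre (I * da z) + r z * qre (da z)) / N z.
  have {}hla : has_partials D la La Lb.
    by apply: has_partials_eq oD _ hla => z Dz; split => //; rewrite /La mulrN.
  have {}hth : has_partials D th (fun z => - Lb z) La.
    apply: has_partials_eq oD _ hth => z Dz; split => //.
    by rewrite /Lb -[RHS]mulNr opprD mulrN.
  have Dc := @stem_domain_conj _ Omega.
  have [la0 _] := has_partials_sym 2^-1 Dc hla; have [_ la1] := has_partials_sym (- 2^-1) Dc hla.
  have [th0 th1] := has_partials_sym 2^-1 Dc hth.
  have [C0 D0] := has_partials_C1 oD (has_partials_slice_pt I la0 th0).
  have [C1 D1] := has_partials_C1 oD (has_partials_slice_pt I th1 la1).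
  exists F0, F1; split => //; last first.
    by move=> J z JJ OJ; apply: fE => //; exists J.
  move=> z Dz; have [-> ->] := D0 z Dz; have [-> ->] := D1 z Dz.
  split; first by congr slice_pt; congr pair; ring.
  rewrite /slice_pt /= opprD -[- (_%:A)]scaleNr -[- (_ *: I)]scaleNr.
  by congr (_ *: _ + _ *: _); ring.
- move=> _ [q [Oq [z _ zq]] <-]; rewrite -zq in Oq *.
  have Dz : D z by exists I.
  rewrite fE // imag_mul_slice_pt // -slice_ptD.
  by eexists; last reflexivity.
Qed.

End Logarithm.

(** * Product domains and slice preserving functions *)

Section HalfPlanes.
Variable R : realType.
Implicit Types (D : set (R * R)) (z : R * R).

Definition upper_part D : set (R * R) := D `&` [set z | 0 < z.2].

(** The two halves of a symmetric set D without real points are disjoint and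
open, so the branches on them are independent; the one on the lower half is
transported to the upper half by conjugation. *)
Lemma glue_arg D (w : R * R -> R * R) (th1 th2 : R * R -> R) : open D ->
  (forall z, D z -> z.2 != 0) -> (forall z, D z -> D (cconj z)) ->
  (forall z, upper_part D z -> {for z, continuous th1} /\ is_arg (w z) (th1 z)) ->
  (forall z, upper_part D z -> {for z, continuous th2} /\ is_arg (w (cconj z)) (th2 z)) ->
  exists th, [/\ forall z, D z -> {for z, continuous th},
    forall z, D z -> is_arg (w z) (th z)
    & forall z, 0 < z.2 -> th z = th1 z /\ th (cconj z) = th2 z].
Proof.
move=> oD nreal Dc h1 h2; pose th z := if 0 < z.2 then th1 z else th2 (cconj z).
have cases z : D z -> upper_part D z \/ z.2 < 0 /\ upper_part D (cconj z).
  move=> Dz; have [z0|z0|z0] := ltgtP 0 z.2; first by left.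
    by right; split => //; split; [exact: Dc|rewrite /= oppr_gt0].
  by have := nreal z Dz; rewrite -z0 eqxx.
exists th; split.
- move=> z Dz; case: (cases z Dz) => [uz|[z0 uz]].
    have [c1 _] := h1 z uz; have [_ z0] := uz.
    have nz : \forall y \near z, 0 < y.2.
      by have := continuous_snd (lt_nbhsr z0).
    rewrite /prop_for /continuous_at /th (_ : 0 < z.2 = true) //.
    apply: cvg_trans c1; apply: near_eq_cvg; apply: filterS nz => y y0.
    by rewrite y0.
  have [c2 _] := h2 _ uz.
  have nz : \forall y \near z, y.2 < 0.
    by have := continuous_snd (lt_nbhsl z0).
  have c2' : th2 (cconj y) @[y --> z] --> th2 (cconj z).
    apply: (@continuous_comp _ _ _ (@cconj R) th2 z); last exact: c2.
    apply: cvg_pair_comp; first exact: continuous_fst.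
    by apply: cvgN; exact: continuous_snd.
  rewrite /prop_for /continuous_at /th ltNge (ltW z0) /=.
  apply: cvg_trans c2'; apply: near_eq_cvg; apply: filterS nz => y y0.
  by rewrite ltNge (ltW y0).
- move=> z Dz; case: (cases z Dz) => [uz|[z0 uz]].
    by have [_ z0] := uz; rewrite /th z0; exact: (h1 z uz).2.
  by rewrite /th ltNge (ltW z0) /=; have := (h2 _ uz).2; rewrite cconjK.
- move=> z z0; rewrite /th z0 /= oppr_gt0 ltNge (ltW z0) /= cconjK.
  by [].
Qed.

End HalfPlanes.

Section StemDomainTopology.
Variables (R : realType) (Omega : set (quat R)).
Hypothesis hOmega : circular_domain Omega.
Hypothesis hcontr : slice_contractible Omega.
Let D := stem_domain Omega.
Let circ : circular Omega. Proof. by case: hOmega. Qed.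
Let oOmega : open Omega. Proof. by case: hOmega. Qed.

Lemma slice_domain_stem : is_slice_domain Omega ->
  connected D /\ @null_homotopic_loops R (R * R)%type D.
Proof.
move=> hs; have [I II [/(_ hs) sc _]] := hcontr.
have AI : Omega `&` slice I `<=` slice I by move=> q [].
have [_ cA nA] := simply_connected_preimage II AI sc.
have E : slice_pt I @^-1` (Omega `&` slice I) = D.
  rewrite /D (stem_domain_preimage circ II); apply/seteqP; split=> z; first by case.
  by move=> Oz; split => //; exists z.
by rewrite -E.
Qed.

Lemma product_domain_nonreal : is_product_domain Omega ->
  forall z, D z -> z.2 != 0.
Proof.
move=> hp z [I II Oz]; apply/eqP => z0.
have : (Omega `&` @real_line R) (slice_pt I z).
  by split => //; exists z.1 => //; rewrite /slice_pt z0 scale0r addr0.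
by rewrite hp.
Qed.

(** The closed and the open half planes cut out the same part of D, as D has no
real points; the latter shows that this part is open. *)
Lemma product_domain_stem : is_product_domain Omega ->
  [/\ upper_part D !=set0, open (upper_part D), connected (upper_part D)
    & @null_homotopic_loops R (R * R)%type (upper_part D : set (R * R))].
Proof.
move=> hp; have [I II [_ /(_ hp) sc]] := hcontr.
have AI : Omega `&` half_slice I `<=` slice I by move=> q [_ [z _ <-]]; exists z.
have [nA cA hA] := simply_connected_preimage II AI sc.
have E : slice_pt I @^-1` (Omega `&` half_slice I) = upper_part D.
  apply/seteqP; split=> [z [Oz [z' z'0 /(slice_pt_inj II) zz]]|z [Dz z0]].
    have Dz : D z by exists I.
    split => //; rewrite /= lt_neqAle eq_sym (product_domain_nonreal hp Dz) /=.
    by rewrite -zz.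
  split; first exact: stem_domainP.
  by exists z => //; exact: ltW.
rewrite -E; split => //; rewrite E; apply: openI; first exact: open_stem_domain.
have -> : [set z : R * R | 0 < z.2] = snd @^-1` [set x : R | 0 < x] by [].
by apply: open_comp (@open_gt R 0) => z _; exact: continuous_snd.
Qed.

End StemDomainTopology.

Section SlicePreserving.
Variables (R : realType) (Omega : set (quat R)).
Hypothesis circ : circular Omega.
Hypothesis oOmega : open Omega.
Let D := stem_domain Omega.
Implicit Types (z : R * R) (I J : quat R).

Lemma slice_comm I q : imag_units I -> slice I q -> I * q = q * I.
Proof.
move=> II [z _ <-]; have -> : I = slice_pt I (0, 1).
  by rewrite /slice_pt /= scale0r scale1r add0r.
have -> : slice_pt (slice_pt I (0, 1)) z = slice_pt I z.
  by congr slice_pt; rewrite /slice_pt /= scale0r scale1r add0r.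
exact: slice_pt_comm.
Qed.

(** G0 and I G1 are the half sum and the half difference of the values at the
conjugate points alpha + I beta and alpha - I beta, which lie in the slice of
I.  Hence G0 and G1 commute with every imaginary unit I, and only real
quaternions do. *)
Lemma slice_preserving_real_stem (g : quat R -> quat R) (G0 G1 : R * R -> quat R) :
  (forall z, D z -> G0 (cconj z) = G0 z /\ G1 (cconj z) = - G1 z) ->
  (forall J z, imag_units J -> Omega (slice_pt J z) ->
    g (slice_pt J z) = G0 z + J * G1 z) ->
  slice_preserving Omega g ->
  forall z, D z -> G0 z = (qre (G0 z))%:A /\ G1 z = (qre (G1 z))%:A.
Proof.
move=> sym gE pres z Dz.
(* The values at z and conj z on the slice of J lie in that slice, hence
   commute with J; so do their half sum and half difference. *)
have comm J : imag_units J -> J * G0 z = G0 z * J /\ J * G1 z = G1 z * J.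
  move=> JJ.
  have val z' : D z' -> slice J (G0 z' + J * G1 z').
    move=> Dz'; have Oz := stem_domainP circ Dz' JJ; rewrite -gE //.
    by apply: (pres J JJ); exists (slice_pt J z') => //; split => //; exists z'.
  have c1 := slice_comm JJ (val z Dz).
  have c2 := slice_comm JJ (val _ (stem_domain_conj Dz)).
  have [e0 e1] := sym z Dz.
  move: c1 c2; rewrite e0 e1 !mulrDr !mulrDl mulrN mulrN mulNr.
  set A := J * G0 z; set A' := G0 z * J; set B := J * (J * G1 z); set B' := J * G1 z * J.
  move=> c1 c2.
  have EA : A = A'.
    rewrite -[A]half_double -[A']half_double; congr (_ *: _).
    have : A + B + (A - B) = A' + B' + (A' - B') by rewrite c1 c2.
    by rewrite addrACA subrr addr0 => ->; rewrite addrACA subrr addr0.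
  split => //; move: c1; rewrite EA => /addrI; rewrite /B /B' mulrA JJ mulN1r => BB.
  have : J * (J * (G1 z * J)) = J * (- G1 z) by rewrite BB !mulrA.
  rewrite !mulrA JJ mulN1r mulNr mulrN => /oppr_inj ->; by [].
by split; apply: commute_units_real => J JJ; have [] := comm J JJ.
Qed.

Lemma slice_pt_representation I J (a b : R) : imag_units I ->
  slice_pt J (a, b) = representation I J (slice_pt I (a, b)) (slice_pt I (a, - b)).
Proof.
move=> II; have -> : slice_pt I (a, b) = a%:A + I * b%:A.
  by rewrite -scalerAr mulr1.
have -> : slice_pt I (a, - b) = a%:A - I * b%:A.
  by rewrite -scalerAr mulr1 /slice_pt /= scaleNr.
by rewrite representation_stem // -scalerAr mulr1.
Qed.

(** The stem of f is real, so the star exponential of f is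
exp a (cos b + I sin b) on the slice of I: b is an argument of g there, odd
because it is the second stem component of f. *)
Lemma slice_preserving_log_polar (g f : quat R -> quat R) (I : quat R) :
  imag_units I -> star_log Omega g f -> slice_preserving Omega f ->
  exists a b : R * R -> R,
  [/\ forall z, D z -> {for z, continuous b},
      forall z, D z -> b (cconj z) = - b z,
      forall J z, imag_units J -> D z -> f (slice_pt J z) = slice_pt J (a z, b z) &
      forall z, D z -> g (slice_pt I z) = slice_pt I (expR (a z) * cos (b z), expR (a z) * sin (b z))].
Proof.
move=> II [[F0 [F1 [C0 C1 sym _ fE]]] expf] pres.
have realF := slice_preserving_real_stem sym fE pres.
have fz J z : imag_units J -> D z -> f (slice_pt J z) = slice_pt J (qre (F0 z), qre (F1 z)).
  move=> JJ Dz; have [e0 e1] := realF z Dz.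
  rewrite fE //; last exact: stem_domainP.
  by rewrite {1}e0 {1}e1 -scalerAr mulr1.
exists (fun z => qre (F0 z)), (fun z => qre (F1 z)); split => //.
- have linre (k : R) (x y : quat R) : qre (k *: (x - y)) = k *: (qre x - qre y).
    by rewrite qreZ qreD qreN.
  have oD : open D by exact: open_stem_domain.
  apply: (partials_continuous oD).
  exact: (has_partials_linear linre (@continuous_qre R) (C1_has_partials C1)).
- by move=> z /sym [_ ->]; rewrite qreN.
- move=> z Dz; have Oz := stem_domainP circ Dz II.
  have fr J : imag_units J -> f (slice_pt J z) = representation I J
      (slice_pt I (qre (F0 z), qre (F1 z))) (slice_pt I (qre (F0 z), - qre (F1 z))).
    by move=> JJ; rewrite fz // -slice_pt_representation.
  have := star_exp_slice II fr II; rewrite /= representation_diag // => lim.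
  exact: (cvg_unique _ (expf _ Oz) lim).
Qed.

End SlicePreserving.

(** * Existence and uniqueness of star logarithms *)

Section SliceValue.
Variables (R : realType) (Omega : set (quat R)).
Hypothesis hOmega : circular_domain Omega.
Hypothesis hcontr : slice_contractible Omega.
Let D := stem_domain Omega.
Let circ : circular Omega. Proof. by case: hOmega. Qed.
Let oOmega : open Omega. Proof. by case: hOmega. Qed.
Let oD : open D. Proof. exact: open_stem_domain. Qed.
Let Dc z : D z -> D (cconj z). Proof. exact: stem_domain_conj. Qed.
Variables (g : quat R -> quat R) (G0 G1 : R * R -> quat R).
Hypothesis G0_C1 : C1_on D G0.
Hypothesis G1_C1 : C1_on D G1.
Hypothesis G_sym : forall z, D z -> G0 (cconj z) = G0 z /\ G1 (cconj z) = - G1 z.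
Hypothesis G_CR : forall z, D z ->
  dalpha G0 z = dbeta G1 z /\ dbeta G0 z = - dalpha G1 z.
Hypothesis gE : forall J z, imag_units J -> Omega (slice_pt J z) ->
  g (slice_pt J z) = G0 z + J * G1 z.
Hypothesis g_neq0 : forall q, Omega q -> g q != 0.

Lemma slice_value_continuous I z : imag_units I -> D z ->
  {for z, continuous (slice_value G0 G1 I)}.
Proof.
move=> II Dz; have [h1 h2] := slice_value_partials circ oOmega II G0_C1 G1_C1 G_CR.
have c1 := partials_continuous oD h1 Dz; have c2 := partials_continuous oD h2 Dz.
have : (fun z => ((slice_value G0 G1 I z).1, (slice_value G0 G1 I z).2)) @ z -->
  ((slice_value G0 G1 I z).1, (slice_value G0 G1 I z).2) by exact: cvg_pair_comp.
by [].
Qed.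

Lemma upper_part_conj z : upper_part D z -> D z /\ D (cconj z).
Proof. by move=> [Dz _]; split => //; exact: Dc. Qed.

(** On a product domain the argument is chosen on the upper half both for g and
for its composite with conjugation. *)
Lemma slice_value_arg I : imag_units I -> preserves_slice Omega g I ->
  exists th, (forall z, D z -> {for z, continuous th}) /\
    (forall z, D z -> is_arg (slice_value G0 G1 I z) (th z)).
Proof.
move=> II pI; set w := slice_value G0 G1 I.
have wc z : D z -> {for z, continuous w} by exact: slice_value_continuous.
have w0 z : D z -> w z != (0, 0) by exact: (slice_value_neq0 circ II gE pI g_neq0).
have [hs|hp] := pselect (is_slice_domain Omega).
  have [cD nD] := slice_domain_stem hOmega hcontr hs.
  have [q [Oq [x _ qx]]] := hs.
  have D0 : D !=set0.
    by exists (x, 0), (quat_i R); [exact: imag_unit_i|rewrite slice_pt_real qx].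
  have [th Hth] := ex_continuous_arg D0 oD cD nD wc w0.
  by exists th; split=> z /Hth[].
have {}hp : is_product_domain Omega.
  by apply: contrapT => /eqP/set0P.
have [D0 oU cU nU] := product_domain_stem hOmega hcontr hp.
have [th1 H1] := ex_continuous_arg D0 oU cU nU (fun z h => wc z (upper_part_conj h).1)
  (fun z h => w0 z (upper_part_conj h).1).
have [|th2 H2] := @ex_continuous_arg R _ (w \o @cconj R) D0 oU cU nU _ (fun z h => w0 _ (upper_part_conj h).2).
  move=> z /upper_part_conj [_ Dz]; apply: continuous_comp; last exact: wc.
  apply: cvg_pair_comp; first exact: continuous_fst.
  by apply: cvgN; exact: continuous_snd.
have [th [th_c th_a _]] := glue_arg oD (product_domain_nonreal hp) Dc H1 H2.
by exists th.
Qed.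

Section Real.
Hypothesis g_pres : slice_preserving Omega g.
Variable I : quat R.
Hypothesis II : imag_units I.
Local Notation w := (slice_value G0 G1 I).
Local Notation la := (log_modulus G0 G1 I).

Lemma slice_value_real z : D z -> w z = (qre (G0 z), qre (G1 z)).
Proof.
move=> Dz; have [e0 e1] := slice_preserving_real_stem circ G_sym gE g_pres Dz.
rewrite /slice_value {1}e0 {1}e1 -scalerAr mulr1.
exact: (slice_coordK II (qre (G0 z), qre (G1 z))).
Qed.

Lemma slice_value_conj z : D z -> w (cconj z) = ((w z).1, - (w z).2).
Proof.
move=> Dz; rewrite (slice_value_real (Dc Dz)) (slice_value_real Dz) /=.
by have [-> ->] := G_sym Dz; rewrite qreN.
Qed.

(** The modulus of g is even under conjugation.  If th is odd, then the stem
components of the logarithm reduce to the real functions la and th. *)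
Lemma odd_arg_logarithm th :
  (forall z, D z -> {for z, continuous th}) -> (forall z, D z -> is_arg (w z) (th z)) ->
  (forall z, D z -> th (cconj z) = - th z) ->
  exists f, [/\ star_log Omega g f, slice_preserving Omega f &
    forall J z, imag_units J -> D z -> f (slice_pt J z) = slice_pt J (la z, th z)].
Proof.
move=> th_c th_a th_odd.
have [f [logf _ fE]] := logarithm_exists circ oOmega II G0_C1 G1_C1 G_sym G_CR gE
  (g_pres II) th_c th_a.
have fz J z : imag_units J -> D z -> f (slice_pt J z) = slice_pt J (la z, th z).
  move=> JJ Dz; rewrite fE //.
  have la_even : la (cconj z) = la z.
    by rewrite /log_modulus slice_value_conj //= sqrrN.
  have -> : log_stem0 G0 G1 I th z = (la z, 0).
    by rewrite /log_stem0 la_even th_odd // subrr mulr0; congr pair; field.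
  have -> : log_stem1 G0 G1 I th z = (th z, 0).
    by rewrite /log_stem1 la_even th_odd // subrr mulr0; congr pair; field.
  by rewrite !slice_pt_real -scalerAr mulr1.
exists f; split => // J JJ _ [q [Oq [z _ zq]] <-]; rewrite -zq in Oq *.
by rewrite fz //; [eexists; last reflexivity|exists J].
Qed.

End Real.
End SliceValue.

Theorem proposition4p1 (R : realType) (Omega : set (quat R))
    (g : quat R -> quat R)
    (hOmega : circular_domain Omega)
    (hcontr : slice_contractible Omega)
    (hg : slice_regular Omega g)
    (hg0 : forall q, Omega q -> g q != 0) :
  [/\ forall I, imag_units I -> preserves_slice Omega g I ->
        exists f, star_log Omega g f /\ preserves_slice Omega f I,
      is_slice_domain Omega -> slice_preserving Omega g ->
        (forall x : R, Omega x%:A -> exists2 c : R, 0 < c & g x%:A = c%:A) ->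
        exists f,
          [/\ star_log Omega g f, slice_preserving Omega f &
              forall f', star_log Omega g f' -> slice_preserving Omega f' ->
                forall q, Omega q -> f' q = f q] &
      is_product_domain Omega -> slice_preserving Omega g ->
        exists f, star_log Omega g f /\ slice_preserving Omega f].
Proof.
have [G0 [G1 [G0_C1 G1_C1 G_sym G_CR gE]]] := hg.
have [_ oOmega _ circ] := hOmega.
set D := stem_domain Omega in G0_C1 G1_C1 G_sym G_CR.
have oD : open D by exact: open_stem_domain.
have Dc z : D z -> D (cconj z) by exact: stem_domain_conj.
have Ui := imag_unit_i R; set i := quat_i R in Ui.
pose w := slice_value G0 G1 i.
have wc z : D z -> {for z, continuous w}.
  exact: slice_value_continuous.
split.
- move=> I II pI.
  have [th [th_c th_a]] := slice_value_arg hOmega hcontr G0_C1 G1_C1 G_CR gE hg0 II pI.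
  have [f [logf pf _]] := logarithm_exists circ oOmega II G0_C1 G1_C1 G_sym G_CR gE
    pI th_c th_a.
  by exists f.
- move=> hs pres pos.
  have [cD nD] := slice_domain_stem hOmega hcontr hs.
  have [q [Oq [x _ qx]]] := hs.
  have Ox : Omega x%:A by rewrite qx.
  have D0 : D (x, 0) by exists i => //; rewrite slice_pt_real.
  have w0 z : D z -> w z != (0, 0).
    exact: (slice_value_neq0 circ Ui gE (pres _ Ui) hg0).
  have wconj z : D z -> w (cconj z) = ((w z).1, - (w z).2).
    by move=> Dz; rewrite /w (slice_value_conj hOmega G_sym gE pres Ui Dz).
  (* Positivity at the real point x fixes the argument 0 there. *)
  have arg0 : is_arg (w (x, 0)) 0.
    have [c c0 gx] := pos x Ox; exists c => //.
    apply: (slice_pt_inj Ui); rewrite cos0 sin0 mulr1 mulr0.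
    rewrite (slice_valueK circ Ui gE (pres _ Ui) D0) -gE ?slice_pt_real //.
  have [th [th_c th_a th0]] := continuous_arg oD cD nD wc w0 D0 arg0.
  have xc : cconj (x, 0) = (x, 0) :> R * R by rewrite /cconj /= oppr0.
  have th_odd z : D z -> th (cconj z) = - th z.
    (* th z and - th (conj z) are arguments of the same vector, and both vanish
       at the real point x. *)
    move=> Dz; pose d z := th z - - th (cconj z).
    have : d z = d (x, 0).
      apply: (@cos1_constant R _ D d) => //.
      - apply: continuous_in_subspaceT => y /set_mem Dy; apply: cvgB; first exact: th_c.
        apply: cvgN; apply: (@continuous_comp _ _ _ (@cconj R) th y); last exact/th_c/Dc.
        apply: cvg_pair_comp; first exact: continuous_fst.
        by apply: cvgN; exact: continuous_snd.
      - move=> y Dy; apply: (@is_arg_cos_sinB _ (w y)); first exact: th_a.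
        have := is_arg_conj (th_a _ (Dc _ Dy)).
        by rewrite wconj //; case: (w y) => u v /=; rewrite opprK.
    by rewrite /d xc th0; lra.
  have [f [logf pf fE]] := odd_arg_logarithm hOmega G0_C1 G1_C1 G_sym G_CR gE pres Ui
    th_c th_a th_odd.
  exists f; split => // f' logf' pf' q' Oq'.
  have [a [b [b_c b_odd f'E gpol]]] := slice_preserving_log_polar circ oOmega Ui logf' pf'.
  have wpol z : D z -> w z = (expR (a z) * cos (b z), expR (a z) * sin (b z)).
    move=> Dz; apply: (slice_pt_inj Ui); rewrite -gpol //.
    rewrite (slice_valueK circ Ui gE (pres _ Ui) Dz) -gE //.
    exact: stem_domainP.
  have b_arg z : D z -> is_arg (w z) (b z).
    by move=> Dz; exists (expR (a z)); rewrite ?expR_gt0 // wpol.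
  have bth z : D z -> b z = th z.
    (* b and th are arguments of the same vector, and both vanish at the real
       point x, the former by oddness. *)
    move=> Dz; pose d z := b z - th z.
    have : d z = d (x, 0).
      apply: (@cos1_constant R _ D d) => //.
      - apply: continuous_in_subspaceT => y /set_mem Dy.
        by apply: cvgB; [exact: b_c|exact: th_c].
      - move=> y Dy; apply: (@is_arg_cos_sinB _ (w y)); [exact: b_arg|exact: th_a].
    have : b (x, 0) = 0 by have := b_odd _ D0; rewrite xc; lra.
    by rewrite /d th0 => ->; lra.
  have [J [z [JJ q'E]]] := slice_decomposition q'; rewrite q'E in Oq' *.
  have Dz : D z by exists J.
  rewrite fE // f'E // bth //; congr (slice_pt _ (_, _)).
  (* exp (log_modulus) and exp (a) are both the modulus of w z; the modulus is
     recovered as the length of the vector in polar form. *)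
  apply: expR_inj.
  have [m m0 wm] := th_a z Dz.
  have [e1 e2] : (expR (log_modulus G0 G1 i z) * cos (th z),
      expR (log_modulus G0 G1 i z) * sin (th z)) =
      (expR (a z) * cos (th z), expR (a z) * sin (th z)).
    by rewrite (exp_log_polar (th_a z Dz)) -/w wpol // bth.
  have cs := cos2Dsin2 (th z).
  set E := expR (log_modulus _ _ _ _) in e1 e2 *; set A := expR (a z) in e1 e2 *.
  rewrite -[A]mulr1 -[E]mulr1 -cs !mulrDr !expr2 !mulrA -e1 -e2.
  by [].
- move=> hp pres.
  have [U0 oU cU nU] := product_domain_stem hOmega hcontr hp.
  have w0 z : D z -> w z != (0, 0).
    exact: (slice_value_neq0 circ Ui gE (pres _ Ui) hg0).
  have wconj z : D z -> w (cconj z) = ((w z).1, - (w z).2).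
    by move=> Dz; rewrite /w (slice_value_conj hOmega G_sym gE pres Ui Dz).
  have [th1 H1] := ex_continuous_arg U0 oU cU nU (fun z h => wc z h.1) (fun z h => w0 z h.1).
  (* The argument on the lower half is imposed by oddness. *)
  have H2 z : upper_part D z ->
      {for z, continuous (fun z => - th1 z)} /\ is_arg (w (cconj z)) (- th1 z).
    move=> Uz; have [c1 a1] := H1 z Uz; split; first exact: cvgN.
    by rewrite wconj; [exact: is_arg_conj|exact: Uz.1].
  have [th [th_c th_a thE]] := glue_arg oD (product_domain_nonreal hp) Dc H1 H2.
  have th_odd z : D z -> th (cconj z) = - th z.
    move=> Dz; have [z0|z0|z0] := ltgtP 0 z.2.
    - by have [-> ->] := thE z z0.
    - have := thE (cconj z); rewrite cconjK /= oppr_gt0 => /(_ z0) [-> ->].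
      by rewrite opprK.
    - by have := product_domain_nonreal hp Dz; rewrite -z0 eqxx.
  have [f [logf pf _]] := odd_arg_logarithm hOmega G0_C1 G1_C1 G_sym G_CR gE pres Ui
    th_c th_a th_odd.
  by exists f.
Qed.
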